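(* For every integer $k \ge 1$: there exist triangulations of $S^{2k} \times S^1$ with $4k+6$ vertices, and there exist triangulations of the nonorientable $S^{2k+1}$-bundle over $S^1$ with $4k+8$ vertices.
   Context: A triangulation of a space $X$ is a simplicial complex whose geometric realization is homeomorphic to $X$. Up to homeomorphism there are exactly two $S^{m}$-bundles over $S^1$: $S^m \times S^1$ and a nonorientable one. *)

(* Defs.v *)
From HB Require Import structures.
From mathcomp Require Import all_boot all_order all_algebra.
From mathcomp Require Import all_classical all_reals all_analysis.

Set Implicit Arguments.
Unset Strict Implicit.
Unset Printing Implicit Defensive.

Import Order.TTheory GRing.Theory Num.Theory.
Import numFieldNormedType.Exports.

Local Open Scope classical_set_scope.
Local Open Scope ring_scope.

(* Spaces are represented as subsets of ambient topological types, carrying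
   the subspace topology. *)

Definition homeomorphism (S T : topologicalType) (A : set S) (B : set T)
    (f : S -> T) : Prop :=
  exists g : T -> S,
    [/\ {within A, continuous f}, {within B, continuous g},
        (forall x, A x -> B (f x) /\ g (f x) = x) &
        (forall y, B y -> A (g y) /\ f (g y) = y)].

Definition homeomorphic (S T : topologicalType) (A : set S) (B : set T) : Prop :=
  exists f : S -> T, homeomorphism A B f.

Definition sphere (R : realType) (m : nat) : set 'rV[R]_m.+1 :=
  [set x : 'rV[R]_m.+1 | \sum_(i < m.+1) x 0 i ^+ 2 = 1].
Arguments sphere : clear implicits.

(* Locally trivial bundle: every point of the base A has a neighbourhood
   A `&` U over which p is, by a homeomorphism compatible with the projections,
   the product of A `&` U and the fiber F. *)
Definition fiber_bundle (S T V : topologicalType)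
    (E : set S) (A : set T) (F : set V) (p : S -> T) : Prop :=
  [/\ {within E, continuous p},
      (forall x, E x -> A (p x)) &
      forall b, A b -> exists U : set T, [/\ open U, U b &
        exists2 h : S -> T * V,
          homeomorphism (E `&` p @^-1` U) ((A `&` U) `*` F) h &
          forall x, E x -> U (p x) -> (h x).1 = p x]].

Definition sphere_bundle_over_circle (R : realType) (m : nat)
    (S : topologicalType) (E : set S) : Prop :=
  exists p : S -> 'rV[R]_2, fiber_bundle E (sphere R 1) (sphere R m) p.

(* Abstract simplicial complex whose vertices are exactly the n elements of
   'I_n; the empty set is not counted as a face. *)
Definition simplicial_complex (n : nat) (K : {set {set 'I_n}}) : Prop :=
  [/\ (forall v : 'I_n, [set v]%SET \in K),
      (forall s : {set 'I_n}, s \in K -> s != finset.set0) &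
      (forall s t : {set 'I_n},
         s \in K -> t \subset s -> t != finset.set0 -> t \in K)].

(* Geometric realization, with the vertices placed at the standard basis
   vectors of R^n: barycentric coordinates supported on a face. *)
Definition realization (R : realType) (n : nat) (K : {set {set 'I_n}}) :
    set 'rV[R]_n :=
  [set x : 'rV[R]_n |
    [/\ forall i, 0 <= x 0 i, \sum_i x 0 i = 1 &
        [set i | x 0 i != 0]%SET \in K]].
Arguments realization R {n} K _.

Definition triangulation (R : realType) (n : nat) (K : {set {set 'I_n}})
    (S : topologicalType) (E : set S) : Prop :=
  simplicial_complex K /\ homeomorphic (realization R K) E.

Definition facet (n : nat) (K : {set {set 'I_n}}) (s : {set 'I_n}) : Prop :=
  s \in K /\ forall t : {set 'I_n}, t \in K -> s \subset t -> t = s.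

(* An orientation of the simplex s is encoded by eps s, relative to the one
   given by the increasing order of its vertices.  With respect to it, s induces
   on its codimension-one face s :\ a, relative to the increasing order again,
   the sign given by the simplicial boundary formula. *)
Definition induced_sign (n : nat) (eps : {set 'I_n} -> bool)
    (s : {set 'I_n}) (a : 'I_n) : int :=
  (-1) ^+ eps s * (-1) ^+ #|[set x in s | (x < a)%N]%SET|.

(* Coherent orientability of a triangulated closed manifold: two facets meeting
   in a common codimension-one face induce opposite orientations on it. *)
Definition orientable (n : nat) (K : {set {set 'I_n}}) : Prop :=
  exists eps : {set 'I_n} -> bool,
    forall (s t : {set 'I_n}) (a b : 'I_n),
      facet K s -> facet K t -> s <> t -> a \in s -> b \in t ->
      (s :\ a = t :\ b)%SET ->
      induced_sign eps s a = - induced_sign eps t b.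

(* The space E being triangulated is, up to homeomorphism, the realization of K;
   the closed manifold E is nonorientable iff its triangulation K is. *)
Definition triangulation_nonorientable_sphere_bundle (R : realType) (m n : nat)
    (K : {set {set 'I_n}}) : Prop :=
  [/\ simplicial_complex K,
      sphere_bundle_over_circle R m (realization R K) &
      ~ orientable K].

(* Main.v *)
(* Let q = m + 2 and n = 2 q + 2. Stacking (m + 2)-simplices one after the other,
   the vertex t replacing at time t one of the q vertices of the current facet,
   gives a tube; its boundary is a triangulated strip with vertex set the
   integers. Adding up barycentric coordinates over the slots, together with the
   height (the barycentre of the vertex labels), identifies this strip with the
   product of the boundary of a (q - 1)-simplex and the line. If the replacement
   pattern is n-periodic up to a permutation of the slots, the quotient by
   translation by n is a complex on n vertices whose realization is the mapping
   torus of that permutation, hence a sphere bundle over the circle. An even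
   permutation is isotopic to the identity: it is a product of an even number of
   reflections, and each of them can be rotated to one fixed reflection. An odd
   one reverses the orientation carried along the strip. Rotating the slots
   cyclically gives the square of a rotation as monodromy, which is even, and
   exchanging two consecutive slots once per period makes it odd. *)
Require Import Defs.
From mathcomp Require Import all_boot all_order all_fingroup all_algebra.
From mathcomp Require Import all_classical all_reals all_analysis.
From mathcomp Require Import zify ring lra.

Set Implicit Arguments.
Unset Strict Implicit.
Unset Printing Implicit Defensive.

Import Order.TTheory GRing.Theory Num.Theory.
Import numFieldNormedType.Exports.

Local Open Scope classical_set_scope.
Local Open Scope ring_scope.

(** Exchanging two slots at the end of a period delays one of them: it stays unfilled for [q + 1]
    steps, and [q + 1 = n / 2]. Modulo [n] an edge of that length does not show which end comes
    first. Since only one such delay occurs per period, the two readings of an edge are never both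
    realized, and this is what saves the injectivity of the quotient. Inverses of homeomorphisms are
    never written down. A compact window of the strip is mapped both to the complex, by [wrap], and
    to a product, by [chart]; the two maps have the same fibres, hence homeomorphic images. A window
    of a full period yields the global product, a window of half a period a local trivialization.
    Translation by a period is not defined on points either, because they are rows of a fixed length
    [N]; points are compared through weight and height, which determine them. *)

(* In an infinite stacked tube the vertex i takes over the slot [slot i] of the
   current (q - 1)-simplex; [lone slot i] says that it keeps it for more than q
   steps. The windows keep the cells short compared with the period n, and
   [slot_gap] makes an edge of length n / 2 determined by its residues mod n. *)
Definition lone (q : nat) (slot : nat -> 'I_q) (i : nat) : Prop :=
  forall u, (i < u < i + q.+1)%N -> slot u != slot i.

Record scheme (q n : nat) := Scheme {
  slot : nat -> 'I_q;
  mono : 'S_q;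
  size_eq : n = (2 * q + 2)%N;
  slot_shift : forall i, slot (i + n) = mono (slot i);
  slot_window : forall t s, exists2 i, (t <= i <= t + q)%N & slot i = s;
  slot_gap : forall i, ~ (lone slot i /\ lone slot (i + q.+1)) }.

(** * Combinatorics of the stacked tube and of its quotient modulo [n] *)

Section Combinatorics.
Variables (q n : nat) (S : scheme q n).
Local Notation slot := (slot S).
Local Notation mono := (mono S).

(* The vertices of the simplex glued at time t: the new vertex t, the one it
   replaces, and the latest vertices of the other slots. *)
Definition live (t i : nat) : bool :=
  (i <= t)%N && all (fun u => slot u != slot i) (index_iota i.+1 t).

(* The representative of r mod n in the interval (t - n, t], for n <= t. *)
Definition unwrap t r := (t - (t + n - r) %% n)%N.

(** Of the facets of the simplex glued at time [t], those opposite to [t] and to the vertex it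
    replaces are interior to the tube. These two vertices share a slot, so that removing the whole
    content of another slot [j] gives precisely the boundary facets; for [j = slot t] both go, and
    the face left is smaller. *)
Definition star (t : nat) (j : 'I_q) : {set 'I_n} :=
  [set r : 'I_n | live t (unwrap t r) && (slot (unwrap t r) != j)]%SET.

(** By [star_shiftM] one period of times is enough. It starts at [n], because [unwrap t] truncates
    its subtraction for smaller [t]. *)
Definition strip_complex : {set {set 'I_n}} :=
  [set F : {set 'I_n} | (F != finset.set0) &&
     [exists t : 'I_n, exists j : 'I_q, F \subset star (t + n) j]]%SET.

Lemma n_gt0 : (0 < n)%N.
Proof. by rewrite (size_eq S); lia. Qed.

Lemma liveP t i : reflect ((i <= t)%N /\
  forall u, (i < u < t)%N -> slot u != slot i) (live t i).
Proof.
apply: (iffP andP) => -[it H]; split=> //.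
  by move=> u hu; apply: (allP H); rewrite mem_index_iota.
by apply/allP => u; rewrite mem_index_iota => /H.
Qed.

Lemma live_le t i : live t i -> (i <= t)%N.
Proof. by case/andP. Qed.

Lemma live_range t i : live t i -> (t <= i + q.+1)%N.
Proof.
move=> /liveP[it H]; rewrite leqNgt; apply/negP => lt_t.
have [u hu su] := slot_window S i.+1 (slot i).
have /H : (i < u < t)%N by lia.
by rewrite su eqxx.
Qed.

Lemma live_inj t i i' : live t i -> live t i' -> slot i = slot i' ->
  [\/ i = i', i = t | i' = t].
Proof.
move=> /liveP[it Hi] /liveP[it' Hi'] e.
case: (ltngtP i i') => [lt_ii'|lt_ii'|->]; last by constructor 1.
- case: (ltngtP i' t) it' => // [lt_i't|->] _; last by constructor 3.
  have /Hi : (i < i' < t)%N by lia.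
  by rewrite e eqxx.
- case: (ltngtP i t) it => // [lt_it|->] _; last by constructor 2.
  have /Hi' : (i' < i < t)%N by lia.
  by rewrite e eqxx.
Qed.

(** Within a slot, vertices only move up as time passes; the injectivity of the height rests on
    this. *)
Lemma live_mono t t' i i' : (t < t')%N -> live t i -> live t' i' ->
  slot i = slot i' -> (i <= i')%N.
Proof.
move=> tt' /liveP[it _] /liveP[_ H'] e; rewrite leqNgt; apply/negP => lt_i.
have /H' : (i' < i < t')%N by lia.
by rewrite e eqxx.
Qed.

Lemma slot_shiftM c i :
  slot (i + c * n) = (mono ^+ c)%g (slot i).
Proof.
elim: c i => [|c IH] i; first by rewrite mul0n addn0 expg0 perm1.
by rewrite mulSn addnCA addnA (addnC n i) IH slot_shift expgS permM.
Qed.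

Lemma slot_eq_shift c i i' :
  (slot (i + c * n) == slot (i' + c * n)) = (slot i == slot i').
Proof. by rewrite !slot_shiftM (inj_eq perm_inj). Qed.

Lemma live_shift t i : live (t + n) (i + n) = live t i.
Proof.
have seq u v : (slot (u + n) == slot (v + n)) = (slot u == slot v).
  by have := slot_eq_shift 1 u v; rewrite mul1n.
apply/liveP/liveP => -[it H]; split; try lia; move=> u hu.
  by rewrite -seq; apply: H; lia.
have -> : u = ((u - n) + n)%N by lia.
by rewrite seq; apply: H; lia.
Qed.

Lemma lone_shift i c : lone slot (i + c * n) <-> lone slot i.
Proof.
split=> H u hu; first by rewrite -(slot_eq_shift c); apply: H; lia.
have -> : u = ((u - c * n) + c * n)%N by lia.
by rewrite slot_eq_shift; apply: H; lia.
Qed.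

Lemma unwrap_range t r : (n <= t)%N -> (unwrap t r <= t < unwrap t r + n)%N.
Proof.
by move=> nt; have := ltn_pmod (t + n - r) n_gt0; rewrite /unwrap; lia.
Qed.

Lemma unwrap_mod t r : (n <= t)%N -> (r < n)%N -> unwrap t r = r %[mod n].
Proof.
move=> nt rn; rewrite /unwrap; set a := (t + n - r)%N.
have lt_a := ltn_pmod a n_gt0; have ea := divn_eq a n.
apply/eqP; rewrite -(eqn_modDr (a %% n)).
have -> : (t - a %% n + a %% n = t)%N by lia.
rewrite modnDmr; have -> : (r + a = t + n)%N by lia.
by rewrite modnDr.
Qed.

Lemma unwrap_eq t i r : (n <= t)%N -> (r < n)%N -> (i <= t < i + n)%N ->
  i = r %[mod n] -> i = unwrap t r.
Proof.
move=> nt rn hi; rewrite -(unwrap_mod nt rn) => e.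
have := unwrap_range r nt; move: hi e; set l := unwrap t r => hi e hl.
have ei := divn_eq i n; have el := divn_eq l n; have lt_m := ltn_pmod i n_gt0.
move: ei el; rewrite e; set m := (l %% n)%N in lt_m * => ei el.
have : (i %/ n = l %/ n)%N by rewrite e in lt_m; nia.
by move=> e2; rewrite ei el e2.
Qed.

Lemma live_unwrap t i : (n <= t)%N -> live t i -> i = unwrap t (i %% n).
Proof.
move=> nt h; have := live_le h; have := live_range h; have := size_eq S => en h1 h2.
by apply: unwrap_eq; rewrite ?ltn_pmod ?n_gt0 ?modn_mod //; lia.
Qed.

Lemma unwrap_shift t r : (n <= t)%N -> (r < n)%N -> unwrap (t + n) r = (unwrap t r + n)%N.
Proof.
move=> nt rn; apply/esym/unwrap_eq => //; first by lia.
  by have := unwrap_range r nt; lia.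
by rewrite modnDr unwrap_mod.
Qed.

Lemma star_shift t j : (n <= t)%N -> star (t + n) (mono j) = star t j.
Proof.
move=> nt; apply/setP => r; rewrite !inE unwrap_shift // live_shift.
by rewrite slot_shift (inj_eq perm_inj).
Qed.

Lemma star_shiftM c t j : (n <= t)%N ->
  star (t + c * n) ((mono ^+ c)%g j) = star t j.
Proof.
move=> nt; elim: c j => [|c IH] j; first by rewrite mul0n addn0 expg0 perm1.
by rewrite mulSn addnCA addnA (addnC n t) expgSr permM -addnA
  [(n + _)%N]addnC addnA star_shift ?IH //; lia.
Qed.

Lemma strip_complexP (F : {set 'I_n}) : reflect
  (F != finset.set0 /\ exists t j, (n <= t)%N /\ F \subset star t j)
  (F \in strip_complex).
Proof.
rewrite inE; apply: (iffP andP) => -[F0 h]; split=> //.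
  by case/existsP: h => t /existsP[j h]; exists (t + n)%N, j; split=> //; lia.
case: h => t [j [nt h]]; apply/existsP.
exists (Ordinal (ltn_pmod t n_gt0)); apply/existsP.
exists ((mono ^+ (t %/ n).-1)^-1 j)%g => /=.
have := star_shiftM (t %/ n).-1 ((mono ^+ (t %/ n).-1)^-1 j)%g
  (leq_addl (t %% n) n); rewrite permKV => <-.
have := n_gt0 => n0; have : (0 < t %/ n)%N by rewrite divn_gt0.
move=> h1; congr (is_true (F \subset star _ _)): h.
by rewrite {1}(divn_eq t n); nia.
Qed.

Lemma strip_complex_simplicial : (1 < q)%N -> simplicial_complex strip_complex.
Proof.
move=> q1; split.
- move=> v; apply/strip_complexP; split.
    by apply/set0Pn; exists v; rewrite inE.
  have [j hj] : exists j, j != slot (v + n).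
    have q0 : (0 < q)%N by lia.
    case: (eqVneq (slot (v + n)) (Ordinal q0)) => [->|h]; last first.
      by exists (Ordinal q0); rewrite eq_sym.
    by exists (Ordinal q1).
  exists (v + n)%N, j; split; first by lia.
  have e : unwrap (v + n) v = (v + n)%N.
    by apply/esym/unwrap_eq; rewrite ?modnDr //; have := n_gt0; lia.
  apply/fintype.subsetP => r; rewrite inE => /eqP ->; rewrite inE e eq_sym hj andbT.
  by apply/liveP; split=> // u; lia.
- by move=> s /strip_complexP[].
- move=> s t /strip_complexP[_ [u [j [nu h]]]] ts t0; apply/strip_complexP.
  by split=> //; exists u, j; split=> //; apply: fintype.subset_trans h.
Qed.

(* The residues of two live vertices determine their distance: it is at most
   q + 1 = n / 2, and the extreme case is excluded by the condition on gaps. *)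
Lemma unwrap_rigid t t' r0 r : (n <= t)%N -> (n <= t')%N -> (r0 < n)%N -> (r < n)%N ->
  live t (unwrap t r0) -> live t (unwrap t r) ->
  live t' (unwrap t' r0) -> live t' (unwrap t' r) ->
  (unwrap t r + unwrap t' r0 = unwrap t' r + unwrap t r0)%N.
Proof.
move=> nt nt' r0n rn l1 l2 l1' l2'.
have [a1 a2] := (live_le l1, live_range l1); have [b1 b2] := (live_le l2, live_range l2).
have [a1' a2'] := (live_le l1', live_range l1').
have [b1' b2'] := (live_le l2', live_range l2').
have ea : unwrap t r0 = unwrap t' r0 %[mod n] by rewrite !unwrap_mod.
have eb : unwrap t r = unwrap t' r %[mod n] by rewrite !unwrap_mod.
move: (unwrap t r0) (unwrap t r) (unwrap t' r0) (unwrap t' r) l1 l2 l1' l2' a1 a2 b1 b2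
  a1' a2' b1' b2' ea eb => i0 i i0' i' l1 l2 l1' l2' a1 a2 b1 b2 a1' a2' b1' b2' ea eb.
have en := size_eq S.
(* The two extreme differences with opposite signs: [u] and [v'] each stay live for [q + 1] steps,
   so both are lone; by congruence [v = u + q + 1] is lone too, against [slot_gap]. *)
have key u v u' v' s s' : live s u -> live s' v' -> (v <= s)%N -> (u' <= s')%N ->
    (s <= u + q.+1)%N -> (s' <= v' + q.+1)%N ->
    v = (u + q.+1)%N -> u' = (v' + q.+1)%N -> u = u' %[mod n] -> v = v' %[mod n] ->
    False.
  move=> /liveP[us hu] /liveP[vs hv] vs' us' su sv ev eu' _ evv.
  apply: (@slot_gap _ _ S u); rewrite -ev; split.
    by clear -hu su sv ev vs'; move=> w hw; apply: hu; lia.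
  have lv' : lone slot v'.
    by clear -hv us' sv eu' ; move=> w hw; apply: hv; lia.
  clear - en evv lv'.
  have := divn_eq v n; have := divn_eq v' n; rewrite evv; set m := (v' %% n)%N.
  move=> e1 e2; case: (leqP (v' %/ n) (v %/ n)) => le_d.
    have -> : v = (v' + (v %/ n - v' %/ n) * n)%N.
      by rewrite mulnBl; have := leq_mul le_d (leqnn n); lia.
    exact/lone_shift.
  apply/(lone_shift v (v' %/ n - v %/ n)).
  have <- // : v' = (v + (v' %/ n - v %/ n) * n)%N.
  by rewrite mulnBl; have := leq_mul (ltnW le_d) (leqnn n); lia.
have := divn_eq i n; have := divn_eq i' n; have := divn_eq i0 n; have := divn_eq i0' n.
rewrite -ea -eb; set m := (i %% n)%N; set m0 := (i0 %% n)%N.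
move: (i %/ n)%N (i' %/ n)%N (i0 %/ n)%N (i0' %/ n)%N => d d' d0 d0' e0' e0 e' e.
case: (eqVneq (i + i0')%N (i' + i0)%N) => // ne; exfalso.
(* The differences [i - i0] and [i' - i0'] agree modulo [n] and are at most [q + 1 = n / 2] in
   absolute value; if they are not equal, they are the two opposite extremes. *)
have [h|h] : (i = i0 + q.+1 /\ i0' = i' + q.+1 \/ i0 = i + q.+1 /\ i' = i0' + q.+1)%N.
- clear - en e e' e0 e0' ne a1 a2 b1 b2 a1' a2' b1' b2'.
  have : (i + i0' + d' * n + d0 * n = i' + i0 + d * n + d0' * n)%N by lia.
  move=> hh; case: (ltngtP (d' + d0) (d + d0')) => hd; last first.
  + by have := congr1 (muln^~ n) hd; lia.
  + have : ((d + d0').+1 * n <= (d' + d0) * n)%N by rewrite leq_mul2r hd orbT.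
    by right; lia.
  + have : ((d' + d0).+1 * n <= (d + d0') * n)%N by rewrite leq_mul2r hd orbT.
    by left; lia.
- by apply: (key i0 i i0' i' t t') => //; case: h.
- by apply: (key i i0 i' i0' t t') => //; case: h.
Qed.

End Combinatorics.

(** * Points of the strip, with labels below [N]: weight and height determine them *)

Section Strip.
Variables (R : realType) (q n : nat) (S : scheme q n) (N : nat).
Local Notation slot := (slot S).
Local Notation mono := (mono S).
Local Notation live := (live S).
Local Notation unwrap := (unwrap n).
Local Notation K := (strip_complex S).
Implicit Types x : 'rV[R]_N.

Definition weight x : 'rV[R]_q := \row_s \sum_(i < N | slot i == s) x 0 i.

Definition height x : R := \sum_(i < N) i%:R * x 0 i.

Definition wrap x : 'rV[R]_n := \row_r \sum_(i < N | (i %% n)%N == r) x 0 i.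

Definition strip t x : Prop :=
  [/\ forall i, 0 <= x 0 i, \sum_i x 0 i = 1,
      forall i, x 0 i != 0 -> live t i &
      exists s, forall i, x 0 i != 0 -> slot i != s].

Definition simplex_boundary : set 'rV[R]_q :=
  [set l | [/\ forall s, 0 <= l 0 s, \sum_s l 0 s = 1 & exists s, l 0 s = 0]].

Lemma sum_weight (phi : 'I_q -> R) x :
  \sum_s phi s * weight x 0 s = \sum_(i < N) phi (slot i) * x 0 i.
Proof.
rewrite (partition_big (fun i : 'I_N => slot i) xpredT) //=.
apply: eq_bigr => s _; rewrite mxE mulr_sumr.
by apply: eq_bigr => i /eqP ->.
Qed.

Lemma strip_weight t x : strip t x -> simplex_boundary (weight x).
Proof.
case=> x0 x1 _ [s hs]; split.
- by move=> u; rewrite mxE; apply: sumr_ge0.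
- by have := sum_weight (fun=> 1) x; under eq_bigr do rewrite mul1r;
    under [in X in _ = X -> _]eq_bigr do rewrite mul1r; rewrite x1.
- exists s; rewrite mxE big1 // => i /eqP si.
  by apply/eqP/negPn/negP => /hs; rewrite si eqxx.
Qed.

Lemma weight_neq0 t x i : strip t x -> x 0 i != 0 -> weight x 0 (slot i) != 0.
Proof.
case=> x0 _ _ _ xi; rewrite mxE (bigD1 i) //=.
have : 0 < x 0 i by rewrite lt_def xi x0.
by move=> h; apply/lt0r_neq0/ltr_pwDl => //; apply: sumr_ge0.
Qed.

Lemma weight_witness x s : weight x 0 s != 0 -> exists2 i : 'I_N, x 0 i != 0 & slot i = s.
Proof.
rewrite mxE => h.
have [i /andP[/eqP si xi]|none] := pickP (fun i : 'I_N => (slot i == s) && (x 0 i != 0)).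
  by exists i.
by move: h; rewrite big1 ?eqxx // => i si; have := none i; rewrite si /= => /negbFE/eqP.
Qed.

Lemma weight_single x s (i0 : 'I_N) : slot i0 = s ->
  (forall i, x 0 i != 0 -> slot i = s -> i = i0) -> weight x 0 s = x 0 i0.
Proof.
move=> s0 h; rewrite mxE (bigD1 i0) ?s0 //= big1 ?addr0 // => i /andP[/eqP si ne].
by apply/eqP/negPn/negP => xi; case/eqP: ne; apply: h.
Qed.

(* Two points with equal weights agree as soon as, slot by slot, their supports
   reduce to one common vertex. *)
Lemma strip_same t t' x x' : strip t x -> strip t' x' -> weight x = weight x' ->
  (forall i i' : 'I_N, slot i = slot i' -> x 0 i != 0 -> x' 0 i' != 0 -> i = i') ->
  x = x'.
Proof.
move=> hx hx' ew key.
have half u v y y' : strip u y -> strip v y' -> weight y = weight y' ->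
    (forall i i' : 'I_N, slot i = slot i' -> y 0 i != 0 -> y' 0 i' != 0 -> i = i') ->
    forall i, y 0 i != 0 -> y 0 i = y' 0 i.
  move=> hy hy' e k i yi.
  have wi := weight_neq0 hy yi.
  have [i' yi' si'] : exists2 i' : 'I_N, y' 0 i' != 0 & slot i' = slot i.
    by apply: weight_witness; rewrite -e.
  have ii' : i = i' by apply: k.
  rewrite -(@weight_single y (slot i) i) // => [|a ya sa]; last first.
    by rewrite ii'; apply: k => //; rewrite sa.
  rewrite e (@weight_single y' (slot i) i) // => a ya sa.
  by apply/esym/k.
apply/rowP => i; case: (eqVneq (x 0 i) 0) => [xi|xi]; last exact: half hx hx' _ _ _ _.
case: (eqVneq (x' 0 i) 0) => [->//|xi']; apply/esym.
by apply: half hx' hx _ _ _ _ => // a b sab ya yb; apply/esym/key.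
Qed.

(** The contribution of each slot to the height can only grow from [t] to [t']. Equal heights forbid
    any growth, which leaves one common vertex in each slot. *)
Lemma strip_inj_lt t t' x x' : (t < t')%N -> strip t x -> strip t' x' ->
  weight x = weight x' -> height x = height x' -> x = x'.
Proof.
move=> tt' hx hx' ew eh; apply: (strip_same hx hx' ew).
have [x0 _ lx _] := hx; have [x0' _ lx' _] := hx'.
(* Pairing all vertices of a slot turns the growth of its moment [M], multiplied by its weight, into
   a sum of terms of known sign. *)
pose D s := \sum_(i < N | slot i == s) \sum_(i' < N | slot i' == s)
  (i'%:R - i%:R) * (x 0 i * x' 0 i').
have term_ge0 (i i' : 'I_N) : slot i = slot i' -> 0 <= (i'%:R - i%:R) * (x 0 i * x' 0 i').
  move=> e; case: (eqVneq (x 0 i) 0) => [->|xi]; first by rewrite mul0r mulr0.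
  case: (eqVneq (x' 0 i') 0) => [->|xi']; first by rewrite !mulr0.
  apply: mulr_ge0; last exact: mulr_ge0.
  by rewrite subr_ge0 ler_nat; apply: (live_mono tt' _ _ e); [apply: lx|apply: lx'].
have D_ge0 s : 0 <= D s.
  apply: sumr_ge0 => i /eqP si; apply: sumr_ge0 => i' /eqP si'.
  by apply: term_ge0; rewrite si si'.
pose M y s := \sum_(i < N | slot i == s) i%:R * (y : 'rV[R]_N) 0 i.
have DE s : D s = weight x 0 s * (M x' s - M x s).
  rewrite /D mulrBr.
  under eq_bigr do under eq_bigr do rewrite mulrBl.
  under eq_bigr do rewrite sumrB.
  rewrite sumrB; congr (_ - _).
    rewrite mxE mulr_suml; apply: eq_bigr => i _; rewrite /M mulr_sumr.
    by apply: eq_bigr => i' _; ring.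
  rewrite ew mxE /M mulr_sumr; apply: eq_bigr => i _; rewrite mulr_suml.
  by apply: eq_bigr => i' _; ring.
have M0 y u s : strip u y -> weight y 0 s = 0 -> M y s = 0.
  move=> hy w0; apply: big1 => i /eqP si.
  case: (eqVneq (y 0 i) 0) => [->|yi]; first by rewrite mulr0.
  by have := weight_neq0 hy yi; rewrite si w0 eqxx.
have Mdiff_ge0 s : 0 <= M x' s - M x s.
  have [w_ge0 _ _] := strip_weight hx.
  case: (eqVneq (weight x 0 s) 0) => [w0|w0].
    by rewrite (M0 x t) // (M0 x' t') ?subrr // -ew.
  by have := D_ge0 s; rewrite DE pmulr_rge0 // lt_def w0 w_ge0.
have heightM y : height y = \sum_s M y s.
  by rewrite /height (partition_big (fun i : 'I_N => slot i) xpredT).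
have Mdiff0 : \sum_s (M x' s - M x s) = 0 by rewrite sumrB -!heightM eh subrr.
move=> i i' e xi xi'.
have /eqP Ds : D (slot i) == 0.
  move/eqP: Mdiff0; rewrite psumr_eq0 // => /allP/(_ (slot i)).
  by rewrite mem_index_enum DE => /(_ isT)/eqP ->; rewrite mulr0.
move/eqP: Ds; rewrite psumr_eq0 => [|a /eqP sa]; last first.
  by apply: sumr_ge0 => b /eqP sb; apply: term_ge0; rewrite sa sb.
move/allP/(_ i); rewrite mem_index_enum => /(_ isT); rewrite eqxx /=.
rewrite psumr_eq0 => [|b /eqP sb]; last by apply: term_ge0; rewrite sb.
move/allP/(_ i'); rewrite mem_index_enum => /(_ isT); rewrite e eqxx /=.
rewrite mulf_eq0 mulf_eq0 (negbTE xi) (negbTE xi') !orbF subr_eq0 eqr_nat.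
by move/eqP => h; apply: val_inj.
Qed.

(* In one cell only the slot receiving the vertex t has two vertices, and there
   the total weight and the height determine both coordinates. *)
Lemma strip_inj_eq t x x' : strip t x -> strip t x' ->
  weight x = weight x' -> height x = height x' -> x = x'.
Proof.
move=> hx hx' ew eh.
have [x0 _ lx _] := hx; have [x0' _ lx' _] := hx'.
have off (i : 'I_N) : slot i != slot t -> x 0 i = x' 0 i.
  move=> st; have one (y : 'rV[R]_N) : (forall a, y 0 a != 0 -> live t a) -> y 0 i = (live t i)%:R * weight y 0 (slot i).
    move=> ly; case: (boolP (live t i)) => li; rewrite ?mul1r ?mul0r; last first.
      by apply/eqP/negPn/negP => /ly; rewrite (negbTE li).
    apply/esym/weight_single => // a ya sa; apply: val_inj => /=.
    have [//|ea|ea] := live_inj (ly _ ya) li sa.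
      by move: st; rewrite -sa ea eqxx.
    by move: st; rewrite -ea eqxx.
  by rewrite (one x) // (one x') // ew.
pose d (i : 'I_N) := x 0 i - x' 0 i.
have d0 (i : 'I_N) : slot i != slot t -> d i = 0 by move=> /off e; rewrite /d e subrr.
have ld (i : 'I_N) : d i != 0 -> live t i.
  apply: contraR => li; rewrite /d.
  have -> : x 0 i = 0 by apply/eqP/negPn/negP => /lx; rewrite (negbTE li).
  have -> : x' 0 i = 0 by apply/eqP/negPn/negP => /lx'; rewrite (negbTE li).
  by rewrite subrr.
have sd : \sum_(i < N) d i = 0.
  by case: hx => _ e _ _; case: hx' => _ e' _ _; rewrite sumrB e e' subrr.
have sh : \sum_(i < N) i%:R * d i = 0.
  under eq_bigr do rewrite mulrBr.
  by rewrite sumrB -/(height x) -/(height x') eh subrr.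
have d_eq0 (i : 'I_N) : (i != t :> nat) -> d i = 0.
  move=> it; apply/eqP/negPn/negP => di.
  have li := ld _ di.
  have si : slot i = slot t by apply/eqP/negPn/negP => /d0 h; rewrite h eqxx in di.
  have other (a : 'I_N) : a != i -> (a != t :> nat) -> d a = 0.
    move=> ai at_; apply/eqP/negPn/negP => da.
    have sa : slot a = slot t by apply/eqP/negPn/negP => /d0 h; rewrite h eqxx in da.
    have [e|e|e] := live_inj (ld _ da) li (etrans sa (esym si)).
    - by move/eqP: ai; apply; apply: val_inj.
    - by rewrite e eqxx in at_.
    - by rewrite e eqxx in it.
  (* The combination of total mass and height with factor [t - a] kills the coordinate at [t] and
     isolates the one at [i]. *)
  have : \sum_(a < N) (t%:R - a%:R) * d a = 0.
    under eq_bigr do rewrite mulrBl.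
    by rewrite sumrB -mulr_sumr sd sh mulr0 subrr.
  rewrite (bigD1 i) //= big1 ?addr0 => [|a ai]; last first.
    case: (eqVneq (a : nat) t) => [->|at_]; first by rewrite subrr mul0r.
    by rewrite other // mulr0.
  move/eqP; rewrite mulf_eq0 (negbTE di) orbF subr_eq0 eqr_nat.
  by rewrite eq_sym (negbTE it).
apply/rowP => i; apply/eqP; rewrite -subr_eq0 -/(d i); apply/eqP.
case: (eqVneq (i : nat) t) => [it|]; last exact: d_eq0.
by move: sd; rewrite (bigD1 i) //= big1 ?addr0 // => a ai; apply: d_eq0; rewrite -it.
Qed.

Lemma strip_inj t t' x x' : strip t x -> strip t' x' ->
  weight x = weight x' -> height x = height x' -> x = x'.
Proof.
case: (ltngtP t t') => [lt|lt|<-] hx hx' ew eh; last exact: strip_inj_eq hx hx' ew eh.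
  exact: strip_inj_lt lt hx hx' ew eh.
by apply/esym; apply: strip_inj_lt lt hx' hx _ _.
Qed.

End Strip.

Lemma scale_sum1 (R : pzRingType) (I : finType) (f : I -> R) (c : R) :
  \sum_i f i = 1 -> c = \sum_i c * f i.
Proof. by move=> f1; rewrite -mulr_sumr f1 mulr1. Qed.

(** * The quotient map [wrap], its fibres, and the existence of lifts *)

Section Wrap.
Variables (R : realType) (q n : nat) (S : scheme q n) (N : nat).
Local Notation slot := (slot S).
Local Notation mono := (mono S).
Local Notation live := (live S).
Local Notation unwrap := (unwrap n).
Local Notation K := (strip_complex S).
Local Notation strip := (strip S).
Local Notation weight := (weight S).
Implicit Types x : 'rV[R]_N.

Lemma strip_unwrap t x (i : 'I_N) : (n <= t)%N -> strip t x -> x 0 i != 0 ->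
  i = unwrap t (i %% n) :> nat.
Proof. by move=> nt [_ _ lx _] /lx; apply: live_unwrap. Qed.

(** The live vertices at one time have distinct residues, so any weighted sum over the support can
    be read off the quotient. *)
Lemma sum_wrap (phi : nat -> R) t x : (n <= t)%N -> strip t x ->
  \sum_(i < N) phi i * x 0 i = \sum_(r < n) phi (unwrap t r) * wrap n x 0 r.
Proof.
move=> nt hx; pose res (i : 'I_N) := Ordinal (ltn_pmod i (n_gt0 S)).
rewrite (partition_big res xpredT) //=; apply: eq_bigr => r _.
rewrite mxE mulr_sumr; apply: eq_big => [i|i /eqP <-] /=.
  by rewrite -val_eqE.
case: (eqVneq (x 0 i) 0) => [->|xi]; first by rewrite !mulr0.
by rewrite -(strip_unwrap nt hx xi).
Qed.

Lemma sum_wrap1 x : \sum_r wrap n x 0 r = \sum_i x 0 i.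
Proof.
pose res (i : 'I_N) := Ordinal (ltn_pmod i (n_gt0 S)).
rewrite [RHS](partition_big res xpredT) //=; apply: eq_bigr => r _.
by rewrite mxE; apply: eq_bigl => i; rewrite -val_eqE.
Qed.

Lemma wrap_witness t x (r : 'I_n) : (n <= t)%N -> strip t x -> wrap n x 0 r != 0 ->
  exists2 i : 'I_N, i = unwrap t r :> nat & x 0 i != 0.
Proof.
move=> nt hx; rewrite mxE => h.
have [i /andP[/eqP si xi]|none] :=
    pickP (fun i : 'I_N => ((i %% n)%N == r) && (x 0 i != 0)).
  by exists i => //; rewrite (strip_unwrap nt hx xi) si.
by move: h; rewrite big1 ?eqxx // => i si; have := none i; rewrite si /= => /negbFE/eqP.
Qed.

Lemma wrap_live t x (r : 'I_n) : (n <= t)%N -> strip t x -> wrap n x 0 r != 0 ->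
  live t (unwrap t r).
Proof.
move=> nt hx /(wrap_witness nt hx)[i <- xi].
by case: hx => _ _ + _; apply.
Qed.

Lemma wrap_realization t x : (n <= t)%N -> strip t x -> realization R K (wrap n x).
Proof.
move=> nt hx; have [x0 x1 lx [s hs]] := hx; split.
- by move=> r; rewrite mxE; apply: sumr_ge0.
- by rewrite sum_wrap1.
apply/strip_complexP; split.
  have [i xi] : exists i, x 0 i != 0.
    have [i xi|none] := pickP (fun i => x 0 i != 0); first by exists i.
    have /eqP := oner_neq0 R; case; rewrite -x1 big1 // => i _.
    by have /negbFE/eqP := none i.
  apply/finset.set0Pn; exists (Ordinal (ltn_pmod i (n_gt0 S))); rewrite inE mxE.
  rewrite (bigD1 i) //=; apply/lt0r_neq0/ltr_pwDl; last exact: sumr_ge0.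
  by rewrite lt_def xi x0.
exists t, s; split=> //; apply/fintype.subsetP => r; rewrite !inE => hr.
by have [i <- xi] := wrap_witness nt hx hr; rewrite lx // hs.
Qed.

(** The effect of a translation by [c] periods, expressed only through height and weight. *)
Definition shifted c x x' : Prop :=
  height x' = height x + (c * n)%:R /\
  forall s, weight x' 0 ((mono ^+ c)%g s) = weight x 0 s.

(** A single residue [r0] of the support fixes the number [c] of periods; [unwrap_rigid] carries the
    same [c] to all the others. *)
Lemma wrap_eq_le t t' x x' : (n <= t)%N -> (n <= t')%N ->
  strip t x -> strip t' x' -> wrap n x = wrap n x' ->
  forall r0 : 'I_n, wrap n x 0 r0 != 0 -> (unwrap t r0 <= unwrap t' r0)%N ->
  exists c, shifted c x x'.
Proof.
move=> nt nt' hx hx' e r0 hr0 le0.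
have hr0' : wrap n x' 0 r0 != 0 by rewrite -e.
have l0 := wrap_live nt hx hr0; have l0' := wrap_live nt' hx' hr0'.
have [c hc] : exists c, unwrap t' r0 = (unwrap t r0 + c * n)%N.
  have := unwrap_mod S nt (ltn_ord r0); rewrite -(unwrap_mod S nt' (ltn_ord r0)).
  set a := unwrap t r0 in le0 *; set b := unwrap t' r0 in le0 * => /esym/eqP.
  by rewrite eqn_mod_dvd // => /dvdnP[c hc]; exists c; lia.
have hl (r : 'I_n) : wrap n x 0 r != 0 -> unwrap t' r = (unwrap t r + c * n)%N.
  move=> hr; have hr' : wrap n x' 0 r != 0 by rewrite -e.
  have := unwrap_rigid nt nt' (ltn_ord r0) (ltn_ord r) l0 (wrap_live nt hx hr)
    l0' (wrap_live nt' hx' hr').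
  by rewrite hc; lia.
exists c; split.
  rewrite /height (sum_wrap (fun i => i%:R) nt hx) (sum_wrap (fun i => i%:R) nt' hx').
  have -> : (c * n)%:R = \sum_(r < n) (c * n)%:R * wrap n x 0 r :> R.
    have [_ w1 _] := wrap_realization nt hx.
    by rewrite -mulr_sumr w1 mulr1.
  rewrite -big_split /=; apply: eq_bigr => r _; rewrite -mulrDl -e.
  case: (eqVneq (wrap n x 0 r) 0) => [->|hr]; first by rewrite !mulr0.
  by rewrite hl // natrD.
have wE u (y : 'rV[R]_N) s : (n <= u)%N -> strip u y ->
    weight y 0 s = \sum_(r < n) (slot (unwrap u r) == s)%:R * wrap n y 0 r.
  move=> nu hy; rewrite -(sum_wrap (fun i => (slot i == s)%:R) nu hy) mxE.
  rewrite big_mkcond /=; apply: eq_bigr => i _.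
  by case: ifP => _; rewrite ?mul1r ?mul0r.
move=> s; rewrite (wE t' x') // (wE t x) // -e; apply: eq_bigr => r _.
case: (eqVneq (wrap n x 0 r) 0) => [->|hr]; first by rewrite !mulr0.
by rewrite hl // slot_shiftM (inj_eq perm_inj).
Qed.

Lemma wrap_eq t t' x x' : (n <= t)%N -> (n <= t')%N ->
  strip t x -> strip t' x' -> wrap n x = wrap n x' ->
  exists c, shifted c x x' \/ shifted c x' x.
Proof.
move=> nt nt' hx hx' e.
have [_ _ /strip_complexP[/finset.set0Pn[r0 + ] _]] := wrap_realization nt hx.
rewrite inE => hr0; case: (leqP (unwrap t r0) (unwrap t' r0)) => [le|/ltnW le].
  by have [c hc] := wrap_eq_le nt nt' hx hx' e hr0 le; exists c; left.
have hr0' : wrap n x' 0 r0 != 0 by rewrite -e.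
by have [c hc] := wrap_eq_le nt' nt hx' hx (esym e) hr0' le; exists c; right.
Qed.

Lemma unroll t (F : {set 'I_n}) j (z : 'rV[R]_n) : (n <= t < N)%N ->
  (F \subset star S t j) -> (forall r, 0 <= z 0 r) -> \sum_r z 0 r = 1 ->
  (forall r, z 0 r != 0 -> r \in F) -> exists2 x : 'rV[R]_N, strip t x & wrap n x = z.
Proof.
move=> /andP[nt tN] Fs z0 z1 zF.
pose x : 'rV[R]_N := \row_i if (i <= t < i + n)%N then
  z 0 (Ordinal (ltn_pmod i (n_gt0 S))) else 0.
have lN (r : 'I_n) : (unwrap t r < N)%N.
  by have := unwrap_range S r nt; lia.
have xl (r : 'I_n) : x 0 (Ordinal (lN r)) = z 0 r.
  rewrite mxE /= (unwrap_range S) //; congr (z 0 _); apply: val_inj => /=.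
  by rewrite (unwrap_mod S) // modn_small.
have x_out (r : 'I_n) (i : 'I_N) : (i %% n)%N = r -> i != Ordinal (lN r) -> x 0 i = 0.
  move=> ir ne; rewrite mxE; case: ifP => // h; case/eqP: ne; apply: val_inj => /=.
  by apply: (unwrap_eq S) => //; rewrite -ir modn_mod.
have wx : wrap n x = z.
  apply/rowP => r; rewrite mxE -xl (bigD1 (Ordinal (lN r))) /=; last first.
    by rewrite (unwrap_mod S) // modn_small.
  by rewrite big1 ?addr0 // => i /andP[/eqP ir ne]; apply: x_out ir ne.
exists x => //.
have xF (i : 'I_N) : x 0 i != 0 -> live t i && (slot i != j).
  move=> xi; pose r := Ordinal (ltn_pmod i (n_gt0 S)).
  have ei : i = Ordinal (lN r).
    by apply/eqP/negPn/negP => /(x_out r) h; rewrite h ?eqxx in xi.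
  have := fintype.subsetP Fs r; rewrite inE => h.
  by rewrite ei /=; apply/h/zF; rewrite -xl -ei.
split.
- by move=> i; rewrite mxE; case: ifP.
- by rewrite -sum_wrap1 wx.
- by move=> i /xF/andP[].
- by exists j => i /xF/andP[].
Qed.

Lemma height_ge t x : strip t x -> t%:R <= height x + n%:R.
Proof.
case=> x0 x1 lx _; rewrite (scale_sum1 t%:R x1) (scale_sum1 n%:R x1) -big_split /=.
apply: ler_sum => i _; rewrite -mulrDl.
case: (eqVneq (x 0 i) 0) => [->|xi]; first by rewrite !mulr0.
apply: ler_wpM2r => //; rewrite -natrD ler_nat.
by have := live_range (lx _ xi); have := size_eq S; lia.
Qed.

Lemma strip_lift_exists z (a : R) : realization R K z ->
  (2 * n)%:R <= a -> a + (2 * n)%:R < N%:R ->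
  exists t (x : 'rV[R]_N), [/\ (n <= t)%N, strip t x, wrap n x = z & a < height x <= a + n%:R].
Proof.
move=> [z0 z1 /strip_complexP[_ [t0' [j0' [nt0' Fs0']]]]] na aN.
have nR : 0 < n%:R :> R by rewrite ltr0n (n_gt0 S).
have [t0 [j0 [/andP[nt0 t0n] Fs]]] : exists t0 j0, (n <= t0 < 2 * n)%N /\
    [set r | z 0 r != 0]%SET \subset star S t0 j0.
  have : [set r | z 0 r != 0]%SET \in K.
    apply/strip_complexP; split; last by exists t0', j0'.
    apply/finset.set0Pn; apply: contra_notP (elimN eqP (oner_neq0 R)) => none.
    rewrite -z1 big1 // => r _; apply/eqP/negPn/negP => hr.
    by apply: none; exists r; rewrite inE.
  rewrite inE => /andP[_ /existsP[t /existsP[j h]]].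
  by exists (t + n)%N, j; split=> //; have := ltn_ord t; lia.
pose h0 := \sum_(r < n) (unwrap t0 r)%:R * z 0 r.
have h0_lt : h0 <= t0%:R.
  rewrite [leRHS](scale_sum1 _ z1); apply: ler_sum => r _.
  by apply: ler_wpM2r => //; rewrite ler_nat; have := unwrap_range S r nt0; lia.
have h0_gt : t0%:R <= h0 + n%:R.
  rewrite (scale_sum1 t0%:R z1) (scale_sum1 n%:R z1) -big_split /=.
  apply: ler_sum => r _; rewrite -mulrDl; apply: ler_wpM2r => //.
  by rewrite -natrD ler_nat; have := unwrap_range S r nt0; lia.
(* A lift at a time between [n] and [2 n] is translated by [c], the greatest number of periods
   keeping the height at most [a + n]. The lower bound on [a] makes [y] nonnegative, the upper bound
   keeps the new time below [N]. *)
pose y := (a + n%:R - h0) / n%:R.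
have t0R : t0%:R <= (2 * n)%:R :> R by rewrite ler_nat; lia.
have y0 : 0 <= y by apply: divr_ge0; lra.
pose c := Num.truncn y.
have /andP[cy yc] := truncn_itv y0.
have hc1 : h0 + (c * n)%:R <= a + n%:R.
  by move: cy; rewrite -/c ler_pdivlMr // natrM; lra.
have hc2 : a < h0 + (c * n)%:R.
  by move: yc; rewrite -/c ltr_pdivrMr // -natr1 mulrDl natrM mul1r; lra.
have tN : (t0 + c * n < N)%N.
  by rewrite -(ltr_nat R) natrD; move: aN; rewrite natrM; lra.
have nt : (n <= t0 + c * n)%N by rewrite (leq_trans nt0) // leq_addr.
have Fs' : [set r | z 0 r != 0]%SET \subset star S (t0 + c * n) ((mono ^+ c)%g j0).
  by rewrite star_shiftM.
have [||x hx wx] := @unroll (t0 + c * n) _ _ z _ Fs' z0 z1.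
- by rewrite nt tN.
- by move=> r hr; rewrite inE.
exists (t0 + c * n)%N, x; split=> //.
suff -> : height x = h0 + (c * n)%:R by rewrite hc2 hc1.
rewrite /height (sum_wrap (fun i => i%:R) nt hx) wx /h0.
rewrite (scale_sum1 (c * n)%:R z1) -big_split /=.
apply: eq_bigr => r _; rewrite -mulrDl -natrD; congr (_%:R * _).
apply/esym/(unwrap_eq S) => //; first by have := unwrap_range S r nt0; rewrite leq_add2r addnAC ltn_add2r.
by rewrite addnC modnMDl (unwrap_mod S).
Qed.

(* The latest vertex of slot s up to time t, or 0 if there is none. *)
Fixpoint last t s : nat :=
  if t is t'.+1 then (if slot t == s then t else last t' s) else 0%N.

Lemma last_max t s u : (last t s < u <= t)%N -> slot u != s.
Proof.
elim: t => [|t IH] /=; first by lia.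
case: ifPn => [_|ns] h; first by lia.
case: (eqVneq u t.+1) => [->//|ut]; apply: IH; lia.
Qed.

Lemma last_le t s : (last t s <= t)%N.
Proof. by elim: t => //= t IH; case: ifP => // _; lia. Qed.

Lemma slot_last t s i : (0 < i <= t)%N -> slot i = s -> slot (last t s) = s.
Proof.
elim: t => [|t IH] /=; first by lia.
case: ifPn => [/eqP-> //|ns] h si; apply: IH => //.
case: (eqVneq i t.+1) => [e|]; last by lia.
by move: ns; rewrite -si e eqxx.
Qed.

Lemma slot_last_window t s : (q < t)%N -> slot (last t s) = s.
Proof.
move=> qt; have [i hi si] := slot_window S (t - q)%N s.
by apply: (@slot_last t s i) => //; lia.
Qed.

Lemma live_last t s : (q < t)%N -> live t (last t s).
Proof.
move=> qt; apply/liveP; split; first exact: last_le.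
by move=> u hu; rewrite slot_last_window //; apply: (@last_max t); lia.
Qed.

Lemma live_lastS t s : (q < t)%N -> live t.+1 (last t s).
Proof.
move=> qt; apply/liveP; split; first by have := last_le t s; lia.
by move=> u hu; rewrite slot_last_window //; apply: (@last_max t); lia.
Qed.

(** Sliding the mass of the slot refilled at time [t + 1] from its old vertex to the new one
    preserves the weights and moves the height affinely. Both vertices are live at [t + 1], so the
    path stays in one cell. *)
Lemma strip_interpolate t (l : 'rV[R]_q) (theta : R) : (q < t)%N -> (t.+1 < N)%N ->
  simplex_boundary l -> 0 <= theta <= 1 ->
  exists x : 'rV[R]_N, [/\ strip t.+1 x, weight x = l &
    height x = \sum_s l 0 s * ((1 - theta) * (last t s)%:R + theta * (last t.+1 s)%:R)].
Proof.
move=> qt tN [l0 l1 [s0 ls0]] /andP[th0 th1].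
pose c s (i : nat) : R := (1 - theta) * (i == last t s)%:R + theta * (i == last t.+1 s)%:R.
pose x : 'rV[R]_N := \row_i (l 0 (slot i) * c (slot i) i).
have c0 s i : 0 <= c s i by apply: addr_ge0; apply: mulr_ge0; rewrite ?ler0n //; lra.
have cE (phi : nat -> R) s : \sum_(i < N | slot i == s) phi i * x 0 i =
    l 0 s * ((1 - theta) * phi (last t s) + theta * phi (last t.+1 s)).
  have pick u : (u < N)%N -> slot u = s ->
      \sum_(i < N | slot i == s) phi i * ((i : nat) == u)%:R = phi u.
    move=> uN su; rewrite (bigD1 (Ordinal uN)) ?su //= eqxx mulr1.
    rewrite big1 ?addr0 // => i /andP[_ ne]; rewrite -val_eqE /= in ne.
    by rewrite (negbTE ne) mulr0.
  rewrite -(pick (last t s)) ?slot_last_window //; last by have := last_le t s; lia.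
  rewrite -(pick (last t.+1 s)) ?slot_last_window //; last 2 first.
    by have := last_le t.+1 s; lia.
    by lia.
  rewrite !mulr_sumr -big_split /= mulr_sumr; apply: eq_bigr => i /eqP si.
  by rewrite mxE si /c; ring.
have sumx (phi : nat -> R) : \sum_(i < N) phi i * x 0 i =
    \sum_s l 0 s * ((1 - theta) * phi (last t s) + theta * phi (last t.+1 s)).
  rewrite (partition_big (fun i : 'I_N => slot i) xpredT) //=.
  by apply: eq_bigr => s _; rewrite cE.
exists x; split.
- split.
  + by move=> i; rewrite mxE; apply: mulr_ge0.
  + have := sumx (fun=> 1); under eq_bigr do rewrite mul1r.
    by move=> ->; rewrite -[RHS]l1; apply: eq_bigr => s _; ring.
  + move=> i; rewrite mxE mulf_eq0 negb_or => /andP[_].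
    rewrite /c; case: (eqVneq (i : nat) (last t (slot i))) => [e _|_].
      by rewrite e live_lastS.
    case: (eqVneq (i : nat) (last t.+1 (slot i))) => [e _|_].
      by rewrite e live_last //; lia.
    by rewrite !mulr0 addr0 eqxx.
  + exists s0 => i; rewrite mxE; apply: contraNneq => ->.
    by rewrite ls0 mul0r.
- apply/rowP => s; rewrite mxE.
  have := cE (fun=> 1) s; under eq_bigr do rewrite mul1r.
  by move=> ->; ring.
- exact: sumx (fun i => i%:R).
Qed.

(** A discrete intermediate value argument: [H t] is the height of the point with weights [l] on the
    latest vertices at time [t]. The required point is interpolated between the last time before [H]
    reaches [h] and the first time after. *)
Lemma strip_surj (l : 'rV[R]_q) (h : R) : simplex_boundary l ->
  (2 * n)%:R <= h -> h + n%:R < N%:R ->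
  exists t (x : 'rV[R]_N), [/\ (n <= t)%N, strip t x, weight x = l & height x = h].
Proof.
move=> hl nh hN; have [l0 l1 _] := hl; have en := size_eq S.
pose H t := \sum_s l 0 s * (last t s)%:R.
have H_le t : H t <= t%:R.
  rewrite [leRHS](scale_sum1 _ l1); apply: ler_sum => s _; rewrite mulrC.
  by apply: ler_wpM2r => //; rewrite ler_nat last_le.
have H_ge t : (q < t)%N -> t%:R <= H t + (q.+1)%:R.
  move=> qt; rewrite (scale_sum1 t%:R l1) (scale_sum1 q.+1%:R l1) -big_split /=.
  apply: ler_sum => s _; rewrite [l 0 s * _]mulrC -mulrDl; apply: ler_wpM2r => //.
  by rewrite -natrD ler_nat; apply/live_range/live_last.
have nN : (3 * n < N)%N.
  by rewrite -(ltr_nat R); move: nh; rewrite !natrM; lra.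
have exT : exists t, (n <= t)%N && (h <= H t).
  exists N.-1; apply/andP; split; first by lia.
  have : N.-1%:R <= H N.-1 + q.+1%:R by apply: H_ge; lia.
  have -> : N.-1%:R = N%:R - 1 :> R by rewrite -subn1 natrB //; lia.
  by move: hN; rewrite en natrD natrM -natr1; have : 0 <= q%:R :> R by []; lra.
have [t' /andP[nt' ht'] t'_min] := ex_minnP exT.
have t'H t : t' = t.+1 -> (n <= t)%N -> H t < h.
  move=> et nt; rewrite ltNge; apply/negP => ht.
  by have := t'_min t; rewrite nt ht => /(_ isT); lia.
(* The time before [t'] must still be at least [n]; indeed [H n <= n < 2 n <= h]. *)
have t'n : t' != n.
  apply/eqP => e; have := H_le n; rewrite -e in nh ht' *.
  by rewrite natrM in nh; have := n_gt0 S; rewrite -(ltr_nat R) -e => n0 ?; lra.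
have t'N : (t' < N)%N.
  case: t' nt' ht' t'_min t'H t'n => [|t] nt' ht' t'_min t'H t'n; first by lia.
  have nt : (n <= t)%N by lia.
  have := t'H t erefl nt; have := H_ge t.
  have -> : (q < t)%N by lia.
  move=> /(_ isT) h1 h2; rewrite -(ltr_nat R) -natr1.
  by move: hN; rewrite en natrD natrM; move: h1; rewrite -natr1; have : 0 <= q%:R :> R by []; lra.
case: t' nt' ht' t'_min t'H t'n t'N => [|t] nt' ht' _ t'H t'n t'N; first by lia.
have nt : (n <= t)%N by lia.
have Hth := t'H t erefl nt.
have d0 : 0 < H t.+1 - H t by lra.
pose theta := (h - H t) / (H t.+1 - H t).
have th01 : 0 <= theta <= 1.
  by rewrite /theta; apply/andP; split; [apply: divr_ge0; lra | rewrite ler_pdivrMr //; lra].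
have qt : (q < t)%N by rewrite en in nt; lia.
have [x [hx wx hgt]] := strip_interpolate qt t'N hl th01.
exists t.+1, x; split=> //; rewrite hgt.
transitivity ((1 - theta) * H t + theta * H t.+1).
  by rewrite /H !mulr_sumr -big_split /=; apply: eq_bigr => s _; ring.
by rewrite /theta; field; rewrite lt0r_neq0.
Qed.

End Wrap.

(** * Continuity into matrices, and quotients of compact sets *)

Section Topology.

Lemma matrix_continuous_at (T : topologicalType) (R : realType) m n
    (f : T -> 'M[R]_(m, n)) (x : T) :
  (forall i j, {for x, continuous (fun y => f y i j)}) -> {for x, continuous f}.
Proof.
move=> cf A [P nP sPA].
have H : \forall y \near x, forall i j, P i j (f y i j).
  apply: filter_forall => i; apply: filter_forall => j.
  exact: cf i j _ (nP i j).
by apply: filterS H => y hy; apply: sPA.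
Qed.

Lemma coord_continuous_at (T : topologicalType) (R : realType) m n
    (f : T -> 'M[R]_(m, n)) (x : T) i j :
  {for x, continuous f} -> {for x, continuous (fun y => f y i j)}.
Proof.
move=> cf; apply: (@continuous_comp _ _ _ f (fun M : 'M[R]_(m, n) => M i j)) => //.
exact: coord_continuous.
Qed.

Lemma sum_continuous_at (T : topologicalType) (R : realType) (I : Type) (r : seq I)
    (P : pred I) (f : I -> T -> R) (x : T) :
  (forall i, {for x, continuous (f i)}) ->
  {for x, continuous (fun y => \sum_(i <- r | P i) f i y)}.
Proof.
move=> cf; have -> : (fun y => \sum_(i <- r | P i) f i y) = \sum_(i <- r | P i) f i.
  by apply/funext => y; rewrite fct_sumE.
elim/big_ind: _ => [|g h cg ch|//]; first exact: cvg_cst.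
exact: continuousD.
Qed.

(** A continuous map from a compact set to a Hausdorff space is closed, hence a quotient map onto
    its image. The point [s0] is only a default for the choice of preimages. *)
Lemma compact_factor (S Y Z : topologicalType) (X : set S) (f : S -> Y) (phi : S -> Z)
    (s0 : S) :
  compact X -> hausdorff_space Y ->
  {within X, continuous f} -> {within X, continuous phi} ->
  (forall x x', X x -> X x' -> f x = f x' -> phi x = phi x') ->
  exists p : Y -> Z, {within f @` X, continuous p} /\
    forall x, X x -> p (f x) = phi x.
Proof.
move=> cX hY cf cphi key.
pose p y := phi (xget s0 [set x | X x /\ f x = y]).
have pE x : X x -> p (f x) = phi x.
  move=> Xx; rewrite /p; have [|X' e] := @xgetPex _ s0 [set x' | X x' /\ f x' = f x].
    by exists x.
  exact: key.
exists p; split=> //; apply/subspace_continuousP => _ [x0 Xx0 <-] W.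
move=> nW; have : nbhs (phi x0) W by rewrite -(pE x0 Xx0).
rewrite nbhsE => -[V [oV Vx0] VW].
(* [X] meets [D] in the points that [phi] sends outside [V]; the image of this compact set is
   closed, and its complement is the neighbourhood sought. *)
have [D clD DX] : exists2 D, closed D & D `&` X = phi @^-1` (~` V) `&` X.
  by apply/closed_subspaceP; apply: (continuous_closedP _).1 cphi _ (open_closedC oV).
have cD : compact (X `&` D) by apply: compact_closedI.
have clfD : closed (f @` (X `&` D)).
  apply: compact_closed hY _; apply: continuous_compact cD.
  by apply: continuous_subspaceW cf; apply: subIsetl.
have nb : nbhs (f x0) (~` (f @` (X `&` D))).
  apply: open_nbhs_nbhs; split; first exact: closed_openC clfD.
  move=> [x [Xx Dx] e]; have [nV _] : (phi @^-1` (~` V) `&` X) x by rewrite -DX.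
  by apply: nV; rewrite /= (key x x0).
apply: filterS nb => y + [x Xx ey]; rewrite -ey => h.
suff Vx : V (phi x) by move: (VW _ Vx); rewrite -(pE x Xx).
apply: contrapT => nV; apply: h; exists x => //.
split=> //; have [] : (D `&` X) x by rewrite DX.
by [].
Qed.

(** With equal fibres the factorization works in both directions, and the two factors are inverse to
    each other. *)
Lemma compact_quotients (S Y Z : topologicalType) (X : set S) (f : S -> Y) (phi : S -> Z)
    (s0 : S) :
  compact X -> hausdorff_space Y -> hausdorff_space Z ->
  {within X, continuous f} -> {within X, continuous phi} ->
  (forall x x', X x -> X x' -> f x = f x' <-> phi x = phi x') ->
  exists p : Y -> Z, homeomorphism (f @` X) (phi @` X) p /\
    forall x, X x -> p (f x) = phi x.
Proof.
move=> cX hY hZ cf cphi key.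
have [p [cp pE]] := compact_factor s0 cX hY cf cphi (fun x x' Xx Xx' => (key x x' Xx Xx').1).
have [r [cr rE]] := compact_factor s0 cX hZ cphi cf (fun x x' Xx Xx' => (key x x' Xx Xx').2).
exists p; split=> //; exists r; split=> //.
  by move=> _ [x Xx <-]; rewrite pE // rE //; split=> //; exists x.
by move=> _ [x Xx <-]; rewrite rE // pE //; split=> //; exists x.
Qed.

Lemma homeomorphism_restrict (S T : topologicalType) (A A' : set S) (B B' : set T)
    (f : S -> T) :
  homeomorphism A B f -> A' `<=` A -> B' `<=` B ->
  (forall x, A x -> A' x <-> B' (f x)) -> homeomorphism A' B' f.
Proof.
move=> [g [cf cg fg gf]] sA sB h; exists g; split.
- exact: continuous_subspaceW cf.
- exact: continuous_subspaceW cg.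
- by move=> x A'x; have [_ ->] := fg x (sA _ A'x); split=> //; apply/h => //; apply: sA.
- move=> y B'y; have [Ag e] := gf y (sB _ B'y); split=> //.
  by apply/h => //; rewrite e.
Qed.

End Topology.

(** * Parametrization of the circle by angles *)

Section Circle.
Variable R : realType.

Definition angle (h : R) : 'rV[R]_2 := \row_i (if i == 0 then cos h else sin h).

Lemma angle0 h : angle h 0 0 = cos h. Proof. by rewrite mxE. Qed.

Lemma angle1 h : angle h 0 1 = sin h. Proof. by rewrite mxE. Qed.

Lemma sphere1E (y : 'rV[R]_2) : sphere R 1 y <-> y 0 0 ^+ 2 + y 0 1 ^+ 2 = 1.
Proof.
rewrite /sphere /= big_ord_recl big_ord1.
by have -> : lift ord0 ord0 = 1 :> 'I_2 by apply: val_inj.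
Qed.

Lemma row2P (y y' : 'rV[R]_2) : y 0 0 = y' 0 0 -> y 0 1 = y' 0 1 -> y = y'.
Proof.
move=> e0 e1; apply/rowP => i; case: (eqVneq i 0) => [->//|i0].
by have -> : i = 1 by apply: val_inj; case: i i0 => -[|[|[]]].
Qed.

Lemma angle_sphere h : sphere R 1 (angle h).
Proof. by apply/sphere1E; rewrite angle0 angle1 cos2Dsin2. Qed.

Lemma angleD2pi h (c : nat) : angle (h + c%:R * (pi *+ 2)) = angle h.
Proof.
elim: c => [|c IH]; first by rewrite mul0r addr0.
rewrite -natr1 mulrDl mul1r addrA -[RHS]IH.
by apply: row2P; rewrite !(angle0, angle1) ?cosD2pi ?sinD2pi.
Qed.

Lemma angle_dot h h' :
  angle h 0 0 * angle h' 0 0 + angle h 0 1 * angle h' 0 1 = cos (h - h').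
Proof. by rewrite !(angle0, angle1) cosB. Qed.

Lemma cos_eq1 (x : R) : 0 <= x < pi *+ 2 -> cos x = 1 -> x = 0.
Proof.
move=> /andP[x0 x2] cx; apply/eqP/negPn/negP => xn0.
have : 0 < sin (x / 2).
  by apply: sin_gt0_pi; move: x2; rewrite mulr2n => x2; rewrite lt_def in xn0 *; lra.
move=> s0; have : cos ((x / 2) *+ 2) = 1 by rewrite -mulr_natr divfK.
rewrite cos_mulr2n cos2sin2 mulrnBl => h.
have : sin (x / 2) ^+ 2 = 0 by lra.
by move/eqP; rewrite expf_eq0 /= (gt_eqF s0).
Qed.

Lemma angle_inj (h h' : R) : h <= h' < h + pi *+ 2 -> angle h = angle h' -> h = h'.
Proof.
move=> hh e; have : cos (h' - h) = 1.
  by rewrite -angle_dot e -!expr2; apply/sphere1E/angle_sphere.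
by move/cos_eq1; lra.
Qed.

Lemma angle_surj (y : 'rV[R]_2) : sphere R 1 y -> exists2 h, 0 <= h < pi *+ 2 & angle h = y.
Proof.
move/sphere1E => hy; have p0 := pi_gt0 R.
have y01 : -1 <= y 0 0 <= 1.
  by rewrite -ler_norml -(@ler_sqr _ _ 1) ?nnegrE // real_normK ?num_real //; nra.
have sy : Num.sqrt (1 - y 0 0 ^+ 2) = `|y 0 1|.
  by rewrite -sqrtr_sqr; congr Num.sqrt; lra.
have a0 := acos_ge0 y01; have api := acos_lepi y01.
case: (leP 0 (y 0 1)) => s.
  exists (acos (y 0 0)); first by rewrite mulr2n; lra.
  apply: row2P; first by rewrite angle0 acosK // in_itv.
  by rewrite angle1 sin_acos // sy ger0_norm.
exists (pi *+ 2 - acos (y 0 0)); last first.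
  apply: row2P; rewrite ?angle0 ?angle1.
    by rewrite -cosN opprB cosB cos2pi sin2pi mulr1 mulr0 addr0 acosK // in_itv.
  by rewrite sinB cos2pi sin2pi mul0r mul1r sub0r sin_acos // sy ltr0_norm // opprK.
have : 0 < acos (y 0 0).
  apply: acos_gt0; rewrite lt_def; nra.
by rewrite mulr2n; lra.
Qed.

Lemma angle_continuous : continuous angle.
Proof.
move=> x; apply: matrix_continuous_at => i j.
have -> : (fun y => angle y i j) = if j == 0 then cos else sin.
  by apply/funext => y; rewrite mxE; case: ifP.
by case: ifP => _; [apply: continuous_cos|apply: continuous_sin].
Qed.

End Circle.

(** * The isotopy by reflections, and the radial projection to the sphere *)

Section Isotopy.
Variable R : realType.

Definition dot q (u v : 'rV[R]_q) : R := \sum_i u 0 i * v 0 i.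

Definition centered q (v : 'rV[R]_q) : Prop := \sum_i v 0 i = 0.

Definition reflect_along q (u v : 'rV[R]_q) : 'rV[R]_q :=
  v - (2 * dot v u / dot u u) *: u.

Lemma dot_eq0 q (u : 'rV[R]_q) : dot u u = 0 -> u = 0.
Proof.
move/eqP; rewrite psumr_eq0 => [/allP h|i _]; last by rewrite -expr2 sqr_ge0.
apply/rowP => i; rewrite mxE; have := h i; rewrite mem_index_enum => /(_ isT).
by rewrite /= mulf_eq0 orbb => /eqP.
Qed.

Lemma dot_gt0 q (u : 'rV[R]_q) : u != 0 -> 0 < dot u u.
Proof.
move=> u0; rewrite lt_def; apply/andP; split; first by apply: contraNneq u0 => /dot_eq0 ->.
by apply: sumr_ge0 => i _; rewrite -expr2 sqr_ge0.
Qed.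

Lemma dotZl q c (u v : 'rV[R]_q) : dot (c *: u) v = c * dot u v.
Proof. by rewrite /dot mulr_sumr; apply: eq_bigr => i _; rewrite mxE mulrA. Qed.

Lemma dotC q (u v : 'rV[R]_q) : dot u v = dot v u.
Proof. by apply: eq_bigr => i _; rewrite mulrC. Qed.

Lemma dotBl q (u v w : 'rV[R]_q) : dot (u - v) w = dot u w - dot v w.
Proof. by rewrite /dot -sumrB; apply: eq_bigr => i _; rewrite !mxE mulrBl. Qed.

Lemma reflect_alongK q (u : 'rV[R]_q) : dot u u != 0 -> involutive (reflect_along u).
Proof.
move=> u0 v; rewrite /reflect_along dotBl dotZl -addrA -opprD -scalerDl.
have -> : 2 * dot v u / dot u u +
    2 * (dot v u - 2 * dot v u / dot u u * dot u u) / dot u u = 0 by field.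
by rewrite scale0r subr0.
Qed.

Lemma reflect_alongZ q (u v : 'rV[R]_q) c :
  reflect_along u (c *: v) = c *: reflect_along u v.
Proof. by rewrite /reflect_along dotZl scalerBr scalerA; congr (_ - _ *: _); ring. Qed.

Lemma reflect_along_centered q (u v : 'rV[R]_q) :
  centered u -> centered v -> centered (reflect_along u v).
Proof.
rewrite /centered => u0 v0; under eq_bigr do rewrite !mxE.
by rewrite sumrB v0 -mulr_sumr u0 mulr0 subrr.
Qed.

Section Path.
Variable m : nat.
Local Notation q := m.+2.

Definition transposition_root (a b : 'I_q) : 'rV[R]_q := delta_mx 0 a - delta_mx 0 b.

(* The two indices are sorted, so that the segment to the reference root below
   avoids the origin. *)
Definition root_path (theta : R) (p : 'I_q * 'I_q) : 'rV[R]_q :=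
  (1 - theta) *: transposition_root 0 1 +
  theta *: (if (p.1 < p.2)%N then transposition_root p.1 p.2
            else transposition_root p.2 p.1).

Lemma root_coord a b s :
  transposition_root a b 0 s = (s == a)%:R - (s == b)%:R.
Proof. by rewrite !mxE !eqxx. Qed.

Lemma dot_root (a b : 'I_q) v : dot v (transposition_root a b) = v 0 a - v 0 b.
Proof.
rewrite /dot; under eq_bigr do rewrite root_coord mulrBr.
have pick c : \sum_i v 0 i * (i == c)%:R = v 0 c.
  rewrite (bigD1 c) //= eqxx mulr1 big1 ?addr0 // => i /negbTE ->.
  by rewrite mulr0.
by rewrite sumrB !pick.
Qed.

Lemma root_centered a b : centered (transposition_root a b).
Proof.
rewrite /centered; have h := dot_root a b (const_mx 1).
rewrite [X in _ = X - _]mxE [X in _ = _ - X]mxE subrr in h; rewrite -[RHS]h.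
by apply: eq_bigr => i _; rewrite [const_mx 1 _ _]mxE mul1r.
Qed.

Lemma root_path_centered theta p : centered (root_path theta p).
Proof.
rewrite /centered; under eq_bigr do rewrite mxE [X in X + _]mxE [X in _ + X]mxE.
rewrite big_split /= -!mulr_sumr root_centered mulr0 add0r.
by case: ifP => _; rewrite root_centered mulr0.
Qed.

(* Pairing with (0, -1, -2, ...) is positive on both ends of the segment. *)
Lemma root_path_neq0 theta p : 0 <= theta <= 1 -> p.1 != p.2 ->
  dot (root_path theta p) (root_path theta p) != 0.
Proof.
move=> /andP[t0 t1] pp; apply/eqP => /dot_eq0 h.
pose w : 'rV[R]_q := \row_i (- (i : nat)%:R).
have : dot (root_path theta p) w = 0.
  by rewrite h /dot big1 // => i _; rewrite mxE mul0r.
have pos (a b : 'I_q) : (a < b)%N -> 1 <= dot (transposition_root a b) w.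
  move=> ab; rewrite dotC dot_root !mxE opprK addrC -natrB; last exact: ltnW.
  by rewrite ler1n subn_gt0.
rewrite /root_path /dot; under eq_bigr do
  rewrite mxE [X in (X + _) * _]mxE [X in (_ + X) * _]mxE mulrDl -!mulrA.
rewrite big_split /= -!mulr_sumr.
have h1 : 1 <= dot (transposition_root 0 1) w by apply: pos.
have h2 : 1 <= dot (if (p.1 < p.2)%N then transposition_root p.1 p.2
            else transposition_root p.2 p.1) w.
  case: ifPn => [/pos //|]; rewrite -leqNgt leq_eqVlt => /orP[|/pos //].
  by move/eqP/val_inj => e; rewrite e eqxx in pp.
by rewrite -/(dot _ w) -/(dot _ w); nra.
Qed.

Lemma reflect_tperm (a b : 'I_q) v s : a != b ->
  reflect_along (transposition_root a b) v 0 s = v 0 (tperm a b s).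
Proof.
move=> ab; rewrite /reflect_along mxE [X in _ + X]mxE [X in _ - X]mxE.
rewrite !dot_root !root_coord !eqxx (negbTE ab) eq_sym (negbTE ab).
rewrite subr0 sub0r opprK -[1 + 1]/(2 : R).
have -> : 2 * (v 0 a - v 0 b) / 2 = v 0 a - v 0 b by field.
case: tpermP => [->|->|/eqP/negbTE -> /eqP/negbTE ->].
- by rewrite eqxx (negbTE ab) /= mulr1n mulr0n; ring.
- by rewrite eqxx eq_sym (negbTE ab) /= mulr1n mulr0n; ring.
- by rewrite /= mulr0n; ring.
Qed.

Definition isotopy (ts : seq ('I_q * 'I_q)) (theta : R) (v : 'rV[R]_q) : 'rV[R]_q :=
  foldr (fun p => reflect_along (root_path theta p)) v ts.

Lemma isotopyZ ts theta c v : isotopy ts theta (c *: v) = c *: isotopy ts theta v.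
Proof. by elim: ts => //= p ts ->; rewrite reflect_alongZ. Qed.

Lemma isotopy_centered ts theta v : centered v -> centered (isotopy ts theta v).
Proof.
move=> v0; elim: ts => //= p ts IH; apply: reflect_along_centered => //.
exact: root_path_centered.
Qed.

Lemma isotopy1 ts v s : all perm.dpair ts ->
  isotopy ts 1 v 0 s = v 0 ((\prod_(t <- ts) tperm t.1 t.2)%g s).
Proof.
elim: ts s => [|p ts IH] s /=; first by rewrite big_nil perm1.
move=> /andP[pp ats]; rewrite big_cons permM -IH // /root_path subrr scale0r add0r scale1r.
case: ifP => _; rewrite reflect_tperm //; last by rewrite eq_sym.
by rewrite tpermC.
Qed.

Lemma isotopy0 ts v : ~~ odd (size ts) -> isotopy ts 0 v = v.
Proof.
move=> ev; have -> : isotopy ts 0 v = iter (size ts) (reflect_along (transposition_root 0 1)) v.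
  elim: ts {ev} => //= p ts ->; congr reflect_along.
  by rewrite /root_path subr0 scale1r scale0r addr0.
have inv : involutive (reflect_along (transposition_root 0 1)).
  apply: reflect_alongK.
  have := @root_path_neq0 0 (0, 1); rewrite lexx ler01 /root_path subr0 scale1r.
  by rewrite scale0r addr0; apply.
rewrite -(odd_double_half (size ts)) (negbTE ev) add0n.
by elim: (size ts)./2 => //= k IH; rewrite IH inv.
Qed.

Lemma isotopy_inj ts theta : 0 <= theta <= 1 -> all perm.dpair ts -> injective (isotopy ts theta).
Proof.
move=> th; elim: ts => [|p ts IH] /=; first by move=> _ v v'.
move=> /andP[pp ats] v v' e; apply: IH => //.
exact: can_inj (reflect_alongK (root_path_neq0 th pp)) _ _ e.
Qed.

Lemma isotopy_surj ts theta w : 0 <= theta <= 1 -> all perm.dpair ts -> centered w ->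
  exists2 v, centered v & isotopy ts theta v = w.
Proof.
move=> th; elim: ts w => [|p ts IH] w /=; first by move=> _ w0; exists w.
move=> /andP[pp ats] w0.
have [|v v0 e] := IH (reflect_along (root_path theta p) w) ats.
  by apply: reflect_along_centered => //; apply: root_path_centered.
by exists v => //; rewrite e reflect_alongK // root_path_neq0.
Qed.

Lemma isotopy_continuous_at (T : topologicalType) ts (theta : T -> R)
    (v : T -> 'rV[R]_q) (x : T) :
  0 <= theta x <= 1 -> all perm.dpair ts ->
  {for x, continuous theta} -> {for x, continuous v} ->
  {for x, continuous (fun y => isotopy ts (theta y) (v y))}.
Proof.
move=> th + cth cv; elim: ts => [//|p ts IH] /= /andP[pp ats].
have {IH} cw := IH ats.
have cu : {for x, continuous (fun y => root_path (theta y) p)}.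
  apply: matrix_continuous_at => i j.
  have -> : (fun y => root_path (theta y) p i j) = (fun y => root_path 0 p i j
     + theta y * (root_path 1 p i j - root_path 0 p i j)).
    by apply/funext => y; rewrite !mxE; ring.
  by apply: continuousD; [exact: cvg_cst | apply: continuousM => //; exact: cvg_cst].
have cdot f g : {for x, continuous f} -> {for x, continuous g} ->
    {for x, continuous (fun y => dot (f y : 'rV[R]_q) (g y))}.
  move=> cf cg; apply: sum_continuous_at => i.
  by apply: continuousM; apply: coord_continuous_at.
apply: matrix_continuous_at => i j.
have -> : (fun y => reflect_along (root_path (theta y) p) (isotopy ts (theta y) (v y)) i j) =
  (fun y => isotopy ts (theta y) (v y) i j -
    (2 * dot (isotopy ts (theta y) (v y)) (root_path (theta y) p) *
      (dot (root_path (theta y) p) (root_path (theta y) p))^-1) * root_path (theta y) p i j).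
  by apply/funext => y; rewrite /reflect_along mxE [X in _ + X]mxE [X in _ - X]mxE.
apply: continuousB; first exact: coord_continuous_at.
apply: continuousM; last exact: coord_continuous_at.
apply: continuousM.
  by apply: continuousM; [exact: cvg_cst | exact: cdot].
by apply: continuousV; [apply: root_path_neq0 | apply: cdot].
Qed.

(** A linear isomorphism from the hyperplane of centered vectors onto the space containing the
    [m]-sphere. It is not an isometry, so lengths are normalized after it. *)
Definition drop_last (v : 'rV[R]_q) : 'rV[R]_m.+1 := \row_i v 0 (widen_ord (leqnSn m.+1) i).

Definition normalize n (w : 'rV[R]_n) : 'rV[R]_n := (Num.sqrt (dot w w))^-1 *: w.

Definition barycentered (l : 'rV[R]_q) : 'rV[R]_q := l - const_mx (q%:R)^-1.

(** Radial projection of the simplex boundary from its barycentre, twisted by the isotopy at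
    parameter [theta]. *)
Definition direction ts theta (l : 'rV[R]_q) : 'rV[R]_m.+1 :=
  normalize (drop_last (isotopy ts theta (barycentered l))).

Lemma drop_lastZ c v : drop_last (c *: v) = c *: drop_last v.
Proof. by apply/rowP => i; rewrite !mxE. Qed.

Lemma centered_recr v : centered v <-> \sum_i drop_last v 0 i + v 0 ord_max = 0.
Proof.
rewrite /centered big_ord_recr /=.
by rewrite [in X in _ <-> X](eq_bigr _ (fun i _ => mxE _ _ _ i)).
Qed.

Lemma drop_last_inj v w : centered v -> centered w -> drop_last v = drop_last w -> v = w.
Proof.
move=> /centered_recr v0 /centered_recr w0 e.
have em : v 0 ord_max = w 0 ord_max.
  by move: v0 w0; rewrite e => v0 w0; apply: (addrI (\sum_i drop_last w 0 i)); rewrite v0 w0.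
apply/rowP => i; case: (unliftP ord_max i) => [j ->|->//].
move/rowP/(_ j): e; rewrite !mxE.
by have -> : widen_ord (leqnSn m.+1) j = lift ord_max j
  by apply: val_inj; rewrite /= /bump leqNgt ltn_ord.
Qed.

Lemma drop_last_surj (y : 'rV[R]_m.+1) : exists2 v, centered v & drop_last v = y.
Proof.
pose v : 'rV[R]_q := \row_i if insub (val i) is Some j then y 0 j else - \sum_j y 0 j.
have dv : drop_last v = y.
  apply/rowP => i; rewrite !mxE insubT //= => h.
  by congr (y 0 _); apply: val_inj.
exists v => //; apply/centered_recr; rewrite dv mxE insubF /= ?subrr //.
by rewrite ltnn.
Qed.

Lemma normalize_sphere n (w : 'rV[R]_n.+1) : w != 0 -> sphere R n (normalize w).
Proof.
move=> /dot_gt0 w0; rewrite /sphere /=; under eq_bigr do rewrite mxE exprMn.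
rewrite -mulr_sumr exprVn sqr_sqrtr ?ltW //.
have -> : \sum_(i < n.+1) w 0 i ^+ 2 = dot w w by apply: eq_bigr => i _; rewrite expr2.
by rewrite mulVf // gt_eqF.
Qed.

Lemma normalize_eq n (w w' : 'rV[R]_n) : w != 0 -> w' != 0 ->
  normalize w = normalize w' -> exists2 c, 0 < c & w = c *: w'.
Proof.
move=> /dot_gt0 w0 /dot_gt0 w'0 e; set a := Num.sqrt (dot w w); set b := Num.sqrt (dot w' w').
have a0 : 0 < a by rewrite sqrtr_gt0.
have b0 : 0 < b by rewrite sqrtr_gt0.
exists (a / b); first exact: divr_gt0.
move/(congr1 ( *:%R a)): e; rewrite !scalerA divff ?gt_eqF // scale1r.
by [].
Qed.

Lemma normalizeZ_sphere n c (y : 'rV[R]_n.+1) : 0 < c -> sphere R n y ->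
  normalize (c *: y) = y.
Proof.
move=> c0 y1; rewrite /normalize dotZl dotC dotZl.
have -> : dot y y = 1 by rewrite -[RHS]y1; apply: eq_bigr => i _; rewrite expr2.
by rewrite mulr1 -expr2 sqrtr_sqr gtr0_norm // scalerA mulVf ?scale1r // gt_eqF.
Qed.

Lemma barycentered_centered l : simplex_boundary l -> centered (barycentered l).
Proof.
case=> _ l1 _; rewrite /centered; under eq_bigr do rewrite !mxE.
rewrite sumrB l1 sumr_const card_ord -[X in _ - X]mulr_natl.
by rewrite mulfV ?subrr // pnatr_eq0.
Qed.

(** A boundary point has a zero coordinate and so is not the barycentre; the isotopy and [drop_last]
    are injective on centered vectors. *)
Lemma isotopy_barycentered_neq0 ts theta l : 0 <= theta <= 1 -> all perm.dpair ts ->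
  simplex_boundary l -> drop_last (isotopy ts theta (barycentered l)) != 0.
Proof.
move=> th ats hl; apply/eqP => h.
have cl := barycentered_centered hl.
have c0 : centered (0 : 'rV[R]_q) by rewrite /centered big1 // => i _; rewrite mxE.
have : isotopy ts theta (barycentered l) = isotopy ts theta (0 *: barycentered l).
  rewrite isotopyZ; apply: drop_last_inj; rewrite ?drop_lastZ ?h ?scaler0 //.
    exact: isotopy_centered.
  by rewrite scale0r.
move/(isotopy_inj th ats); rewrite scale0r => /rowP e.
have [_ _ [s ls]] := hl; have := e s; rewrite !mxE ls sub0r => /eqP.
by rewrite oppr_eq0 invr_eq0 pnatr_eq0.
Qed.

Lemma direction_sphere ts theta l : 0 <= theta <= 1 -> all perm.dpair ts ->
  simplex_boundary l -> sphere R m (direction ts theta l).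
Proof. by move=> th ats hl; apply/normalize_sphere/isotopy_barycentered_neq0. Qed.

Lemma direction_inj ts theta l l' : 0 <= theta <= 1 -> all perm.dpair ts ->
  simplex_boundary l -> simplex_boundary l' ->
  direction ts theta l = direction ts theta l' -> l = l'.
Proof.
move=> th ats hl hl' /normalize_eq[||c c0]; try exact: isotopy_barycentered_neq0.
rewrite -drop_lastZ -isotopyZ => /drop_last_inj e.
have {e} /(isotopy_inj th ats)/rowP e :
    isotopy ts theta (barycentered l) = isotopy ts theta (c *: barycentered l').
  apply: e; rewrite ?isotopyZ; first exact/isotopy_centered/barycentered_centered.
  rewrite -isotopyZ; apply: isotopy_centered.
  rewrite /centered; under eq_bigr do rewrite mxE.
  by rewrite -mulr_sumr (barycentered_centered hl') mulr0.
have {}e s : l 0 s - q%:R^-1 = c * (l' 0 s - q%:R^-1) by have := e s; rewrite !mxE.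
have i0 : 0 < q%:R^-1 :> R by rewrite invr_gt0 ltr0n.
have [l0 _ [s ls]] := hl; have [l0' _ [s' ls']] := hl'.
have e1 := e s; have e2 := e s'; have p1 := l0 s'; have p2 := l0' s.
rewrite ls in e1; rewrite ls' in e2.
have pc : 0 <= c * l' 0 s by apply: mulr_ge0 => //; apply: ltW.
(* Two boundary points on one ray from the barycentre: nonnegativity of [l'] at a zero of [l] gives
   [c >= 1], and nonnegativity of [l] at a zero of [l'] gives [c <= 1]. *)
have c1 : c = 1.
  move: i0 e1 e2; rewrite !mulrBr; move: (q%:R^-1 : R) => i i0 e1 e2.
  by apply/eqP; rewrite eq_le; apply/andP; split; rewrite -(ler_pM2r i0); lra.
by apply/rowP => a; have := e a; rewrite c1 mul1r => /addIr.
Qed.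

Lemma direction_surj ts theta y : 0 <= theta <= 1 -> all perm.dpair ts -> sphere R m y ->
  exists2 l, simplex_boundary l & direction ts theta l = y.
Proof.
move=> th ats hy; have [w cw dw] := drop_last_surj y.
have [v cv ev] := isotopy_surj th ats cw.
pose s0 := [arg min_(s < ord0) v 0 s]%O.
have vmin s : v 0 s0 <= v 0 s by rewrite /s0; case: arg_minP => // i _ ->.
have v0 : v 0 s0 < 0.
  rewrite ltNge; apply/negP => h.
  have vz : v = 0 *: v.
    rewrite scale0r; apply/rowP => s; rewrite mxE; apply/eqP.
    move/eqP: cv; rewrite psumr_eq0 => [/allP/(_ s)|i _]; last exact: le_trans h _.
    by rewrite mem_index_enum => /(_ isT).
  have : dot y y = 0.
    by rewrite -dw -ev vz isotopyZ drop_lastZ !scale0r /dot big1 // => i _; rewrite mxE mul0r.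
  have -> : dot y y = 1 by rewrite -[RHS]hy; apply: eq_bigr => i _; rewrite expr2.
  by move/eqP; rewrite oner_eq0.
(* The factor by which the ray through [v] leaves the simplex: it brings the smallest coordinate of
   [l] to 0. *)
pose r := - (q%:R * v 0 s0)^-1.
have q0 : 0 < q%:R :> R by rewrite ltr0n.
have r0 : 0 < r by rewrite oppr_gt0 invr_lt0 pmulr_rlt0.
have rv : r * v 0 s0 = - q%:R^-1.
  by rewrite /r invfM mulNr -mulrA mulVf ?mulr1 // lt_eqF.
pose l := const_mx q%:R^-1 + r *: v.
have bl : barycentered l = r *: v by rewrite /barycentered /l addrC addKr.
exists l; last by rewrite /direction bl isotopyZ ev drop_lastZ dw normalizeZ_sphere.
split.
- move=> s; rewrite !mxE; have : r * v 0 s0 <= r * v 0 s by rewrite ler_pM2l.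
  by rewrite rv -subr_ge0 opprK addrC.
- under eq_bigr do rewrite !mxE.
  rewrite big_split /= -mulr_sumr cv mulr0 addr0 sumr_const card_ord -[LHS]mulr_natl.
  by rewrite mulfV // gt_eqF.
- by exists s0; rewrite !mxE rv subrr.
Qed.

Lemma direction_continuous_at (T : topologicalType) ts (theta : T -> R)
    (l : T -> 'rV[R]_q) (x : T) :
  0 <= theta x <= 1 -> all perm.dpair ts -> simplex_boundary (l x) ->
  {for x, continuous theta} -> {for x, continuous l} ->
  {for x, continuous (fun y => direction ts (theta y) (l y))}.
Proof.
move=> th ats hl cth cl.
have cv : {for x, continuous (fun y => isotopy ts (theta y) (barycentered (l y)))}.
  apply: isotopy_continuous_at => //; apply: continuousB => //; exact: cvg_cst.
pose w y := drop_last (isotopy ts (theta y) (barycentered (l y))).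
have cw i : {for x, continuous (fun y => w y 0 i)}.
  have -> : (fun y => w y 0 i) = (fun y => isotopy ts (theta y) (barycentered (l y)) 0
      (widen_ord (leqnSn m.+1) i)) by apply/funext => y; rewrite mxE.
  exact: coord_continuous_at.
apply: matrix_continuous_at => i j; rewrite ord1.
have -> : (fun y => direction ts (theta y) (l y) 0 j) =
    (fun y => (Num.sqrt (dot (w y) (w y)))^-1 * w y 0 j).
  by apply/funext => y; rewrite mxE.
apply: continuousM => //; apply: continuousV.
  by rewrite gt_eqF // sqrtr_gt0 dot_gt0 // isotopy_barycentered_neq0.
apply: (@continuous_comp _ _ _ (fun y => dot (w y) (w y)) (@Num.sqrt R)).
  by apply: sum_continuous_at => a; apply: continuousM.
exact: sqrt_continuous.
Qed.

End Path.
End Isotopy.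

Lemma unit_cube_compact (R : realType) k :
  compact [set x : 'rV[R]_k | forall i, 0 <= x 0 i <= 1].
Proof.
have h := @rV_compact R k (fun=> `[0, 1]%classic) (fun=> @segment_compact R 0 1).
have -> : [set x : 'rV[R]_k | forall i, 0 <= x 0 i <= 1] =
   [set v : 'rV[R]_k | forall i, `[0, 1]%classic (v ord0 i)]; last exact: h.
by apply/seteqP; split=> x /= hx i; have := hx i; rewrite in_itv.
Qed.

(** * Windows of the strip and their charts *)

Section Chart.
Variables (R : realType) (m n : nat).
Local Notation q := m.+2.
Variable S : scheme q n.
Local Notation N := (8 * n)%N.
Local Notation K := (strip_complex S).
Local Notation mono := (mono S).
Local Notation strip := (strip S).
Local Notation weight := (weight S).
Implicit Types x : 'rV[R]_N.

(** The length [N = 8 * n] leaves room on both sides: the windows used below lie between heights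
    [2 n] and [5 n], and lifts and cells need up to three more periods above. *)
Definition window (a b : R) : set 'rV[R]_N :=
  [set x | (exists2 t, (n <= t)%N & strip t x) /\ a <= height x <= b].

Definition phase (h : R) : 'rV[R]_2 := angle (h * (pi *+ 2 / n%:R)).

Lemma linear_continuous_at (T : topologicalType) k (c : 'I_k -> R) (P : pred 'I_k)
    (f : T -> 'rV[R]_k) (x : T) : {for x, continuous f} ->
  {for x, continuous (fun y => \sum_(i | P i) c i * f y 0 i)}.
Proof.
move=> cf; apply: sum_continuous_at => i; apply: continuousM; first exact: cvg_cst.
exact: coord_continuous_at.
Qed.

Lemma height_continuous : continuous (@height R N).
Proof. by move=> x; apply: linear_continuous_at; exact: cvg_id. Qed.

Lemma coord_sum_continuous k (P : 'I_k -> pred 'I_N) :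
  continuous (fun x => (\row_j \sum_(i < N | P j i) x 0 i) : 'rV[R]_k).
Proof.
move=> x; apply: matrix_continuous_at => a j.
have -> : (fun x => (\row_j \sum_(i < N | P j i) x 0 i) a j) =
    (fun x => \sum_(i < N | P j i) 1 * x 0 i).
  by apply/funext => y; rewrite mxE; apply: eq_bigr => i _; rewrite mul1r.
by apply: linear_continuous_at; exact: cvg_id.
Qed.

Lemma wrap_continuous : continuous (@wrap R n N).
Proof. exact: coord_sum_continuous. Qed.

Lemma weight_continuous : continuous (fun x => weight x).
Proof. exact: coord_sum_continuous. Qed.

Lemma n_gt0R : 0 < n%:R :> R. Proof. by rewrite ltr0n (n_gt0 S). Qed.

Lemma closed_preimage_le (f : 'rV[R]_N -> R) c :
  continuous f -> closed [set x | f x <= c].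
Proof. by move=> cf; exact: ((continuous_closedP f).1 cf _ (@closed_le _ c)). Qed.

Lemma closed_preimage_ge (f : 'rV[R]_N -> R) c :
  continuous f -> closed [set x | c <= f x].
Proof. by move=> cf; exact: ((continuous_closedP f).1 cf _ (@closed_ge _ c)). Qed.

Lemma closed_preimage_eq (f : 'rV[R]_N -> R) c :
  continuous f -> closed [set x | f x = c].
Proof. by move=> cf; exact: ((continuous_closedP f).1 cf _ (@closed_eq _ c)). Qed.

Lemma window_compact a b : b + n%:R < N%:R -> compact (window a b).
Proof.
move=> bN.
pose cell (p : 'I_N * 'I_q) : set 'rV[R]_N :=
  [set x : 'rV[R]_N | forall i : 'I_N, ~~ (live S p.1 i && (slot S i != p.2)) -> x 0 i = 0].
have cell_closed p : closed (cell p).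
  have -> : cell p = \bigcap_(i in [set i : 'I_N | ~~ (live S p.1 i && (slot S i != p.2))])
      [set x : 'rV[R]_N | x 0 i = 0].
    by apply/seteqP; split=> x h i /=; apply: h.
  apply: closed_bigI => i _; apply: closed_preimage_eq; exact: coord_continuous.
pose pts : {set 'I_N * 'I_q} := [set p : 'I_N * 'I_q | (n <= p.1)%N]%SET.
have cells_closed : closed (\bigcup_(p in [set` pts]) cell p).
  by apply: closed_bigcup => //; apply: finite_finset.
have nonneg_closed : closed (\bigcap_(i in [set: 'I_N]) [set x : 'rV[R]_N | 0 <= x 0 i]).
  by apply: closed_bigI => i _; apply: closed_preimage_ge; exact: coord_continuous.
have sum_closed : closed [set x : 'rV[R]_N | \sum_i x 0 i = 1].
  apply: closed_preimage_eq; have -> : (fun x : 'rV[R]_N => \sum_i x 0 i) =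
    (fun x => \sum_i 1 * x 0 i).
    by apply/funext => x; apply: eq_bigr => i _; rewrite mul1r.
  by move=> x; apply: linear_continuous_at; exact: cvg_id.
have -> : window a b = [set x : 'rV[R]_N | forall i, 0 <= x 0 i <= 1] `&`
   (((\bigcup_(p in [set` pts]) cell p) `&`
    (\bigcap_(i in [set: 'I_N]) [set x : 'rV[R]_N | 0 <= x 0 i])) `&`
    ([set x : 'rV[R]_N | \sum_i x 0 i = 1] `&`
    ([set x | a <= height x] `&` [set x | height x <= b]))).
  apply/seteqP; split=> x /=.
    move=> [[t nt hx] /andP[ax xb]]; have [x0 x1 lx [s hs]] := hx; split.
      move=> i; rewrite x0 -x1 (bigD1 i) //= lerDl.
      by apply: sumr_ge0.
    split; last by split=> //; split.
    split; last by move=> i _; apply: x0.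
    (* The bound on the height bounds the time, so only finitely many closed cells meet the
       window. *)
    have tN : (t < N)%N.
      rewrite -(ltr_nat R); apply: le_lt_trans bN.
      by apply: le_trans (height_ge hx) _; rewrite lerD2r.
    exists (Ordinal tN, s); first by rewrite /= inE.
    move=> i /=; apply: contraNeq => xi; rewrite lx // hs //.
  move=> [_ [[[[t s] + hc] x0] [x1 [ax xb]]]]; rewrite /= inE /= => nt.
  split; last by rewrite ax xb.
  have hc' (i : 'I_N) : x 0 i != 0 -> live S t i && (slot S i != s).
    by apply: contraR => h; rewrite hc.
  exists t => //; split=> //.
  - by move=> i; exact: (x0 i I).
  - by move=> i /hc'/andP[].
  - by exists s => i /hc'/andP[].
apply: compact_closedI; first exact: unit_cube_compact.
apply: closedI; first exact: closedI.
apply: closedI => //; apply: closedI.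
  by apply: closed_preimage_ge; exact: height_continuous.
by apply: closed_preimage_le; exact: height_continuous.
Qed.

Lemma phaseD h (c : nat) : phase (h + (c * n)%:R) = phase h.
Proof.
rewrite /phase mulrDl -(angleD2pi (h * _) c); congr (angle (_ + _)).
by rewrite natrM; field; rewrite gt_eqF // n_gt0R.
Qed.

Lemma phase_inj h h' : h <= h' < h + n%:R -> phase h = phase h' -> h = h'.
Proof.
move=> hh; have n0 := n_gt0R; have p0 := pi_gt0 R.
pose w : R := pi *+ 2 / n%:R.
have w0 : 0 < w by apply: divr_gt0 => //; rewrite mulr2n; lra.
have e : pi *+ 2 = n%:R * w by rewrite /w mulrC divfK // gt_eqF.
rewrite /phase -/w => /angle_inj; rewrite e -mulrDl ler_pM2r // ltr_pM2r // => /(_ hh).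
by move/(mulIf (lt0r_neq0 w0)).
Qed.

Lemma phase_surj (y : 'rV[R]_2) (a : nat) : sphere R 1 y ->
  exists2 h, (a * n)%:R <= h < (a * n)%:R + n%:R & phase h = y.
Proof.
move=> /angle_surj[g /andP[g0 g2] <-]; have n0 := n_gt0R; have p0 := pi_gt0 R.
have p2 : 0 < pi *+ 2 :> R by rewrite mulr2n; lra.
exists (g * (n%:R / (pi *+ 2)) + (a * n)%:R).
  have h0 : 0 <= g * (n%:R / (pi *+ 2)) by apply: mulr_ge0 => //; apply: divr_ge0; apply: ltW.
  have h1 : g * (n%:R / (pi *+ 2)) < n%:R.
    by rewrite mulrA ltr_pdivrMr // mulrC ltr_pM2l.
  by lra.
rewrite phaseD /phase; congr angle; move: (pi *+ 2) p2 => p p2.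
by field; rewrite !gt_eqF.
Qed.

Lemma phase_sphere h : sphere R 1 (phase h). Proof. exact: angle_sphere. Qed.

Lemma phase_continuous : continuous phase.
Proof.
move=> h; apply: continuous_comp; last exact: angle_continuous.
by apply: continuousM; [exact: cvg_id | exact: cvg_cst].
Qed.

Lemma shifted_phase c x x' : shifted S c x x' -> phase (height x') = phase (height x).
Proof. by case=> -> _; rewrite phaseD. Qed.

(* Either the window is too short to contain two lifts of one point, or it has
   length n and the isotopy undoes the monodromy between its two ends. *)
Definition monodromy_trivialized (a b : R) ts : Prop :=
  b < a + n%:R \/ (b = a + n%:R /\
    forall v : 'rV[R]_q, isotopy ts 0 v = v /\ forall s, isotopy ts 1 v 0 s = v 0 (mono s)).

(** The isotopy parameter grows by one per period, so that over a full period the twist compensates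
    the monodromy. *)
Definition chart a ts x : 'rV[R]_m.+1 * 'rV[R]_2 :=
  (direction ts ((height x - a) / n%:R) (weight x), phase (height x)).

Section Window.
Variables (a b : R) (ts : seq ('I_q * 'I_q)).
Hypotheses (ats : all perm.dpair ts) (na : (2 * n)%:R <= a) (bN : b + (3 * n)%:R < N%:R).
Hypothesis triv : monodromy_trivialized a b ts.

Lemma window_length : b <= a + n%:R.
Proof. by case: triv => [/ltW|[-> _]]. Qed.

Lemma window_time h : a <= h <= b -> 0 <= (h - a) / n%:R <= 1.
Proof.
move=> /andP[ah hb]; have n0 := n_gt0R; have wl := window_length.
apply/andP; split; first by apply: divr_ge0; [lra | exact: ltW].
by rewrite ler_pdivrMr // mul1r; lra.
Qed.

Lemma window_weight x : window a b x -> simplex_boundary (weight x).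
Proof. by case=> -[t _ /strip_weight]. Qed.

Lemma chart_continuous : {within window a b, continuous (chart a ts)}.
Proof.
rewrite continuous_subspace_in => x /set_mem Wx.
have ch : {for x, continuous (fun y : subspace (window a b) => height y)}.
  by apply: (continuous_subspaceT height_continuous).
have cd : {for x, continuous (fun y : subspace (window a b) =>
    direction ts ((height y - a) / n%:R) (weight y))}.
  apply: (@direction_continuous_at R m (subspace (window a b)) ts
    (fun y => (height y - a) / n%:R) (fun y => weight y) x) => //.
  - by apply: window_time; case: Wx.
  - exact: window_weight.
  - apply: continuousM; last exact: cvg_cst.
    by apply: continuousB => //; exact: cvg_cst.
  - by apply: (continuous_subspaceT weight_continuous).
have cp : {for x, continuous (fun y : subspace (window a b) => phase (height y))}.
  apply: (@continuous_comp (subspace (window a b)) R _ (fun y => height y) phase) => //.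
  exact: phase_continuous.
exact: (cvg_pair cd cp).
Qed.

(** Two window points one period apart can only be at its two ends, where the isotopy is the
    identity and the monodromy. *)
Lemma chart_ends x x' : window a b x -> window a b x' -> height x' = height x + n%:R ->
  [/\ height x = a, height x' = a + n%:R &
  forall l l', simplex_boundary l -> simplex_boundary l' ->
    direction ts ((height x - a) / n%:R) l = direction ts ((height x' - a) / n%:R) l' <->
    forall s, l' 0 (mono s) = l 0 s].
Proof.
move=> [_ hx] [_ hx'] e; have n0 := n_gt0R.
case: triv => [short|[eb iso]]; first by exfalso; lra.
have ea : height x = a by lra.
have ea' : height x' = a + n%:R by lra.
split=> // l l' hl hl'.
have -> : (height x - a) / n%:R = 0 by rewrite ea subrr mul0r.
have -> : (height x' - a) / n%:R = 1 by rewrite ea' addrC addKr divff // gt_eqF.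
pose l'' : 'rV[R]_q := \row_s l' 0 (mono s).
have hl'' : simplex_boundary l''.
  have [l0 l1 [s ls]] := hl'; split.
  - by move=> u; rewrite mxE.
  - by rewrite -[RHS]l1 [RHS](reindex_inj (@perm_inj _ mono)); apply: eq_bigr => u _; rewrite mxE.
  - by exists ((mono^-1)%g s); rewrite mxE permKV.
have -> : direction ts 1 l' = direction ts 0 l''.
  rewrite /direction (iso (barycentered l'')).1; congr (normalize (drop_last _)).
  by apply/rowP => s; rewrite (iso _).2 !mxE.
split=> [ed s|h].
  have th : 0 <= (0 : R) <= 1 by rewrite lexx ler01.
  by rewrite (direction_inj th ats hl hl'' ed) mxE.
by congr direction; apply/rowP => s; rewrite mxE h.
Qed.

Lemma wrap_chart x x' : window a b x -> window a b x' ->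
  wrap n x = wrap n x' <-> chart a ts x = chart a ts x'.
Proof.
move=> Wx Wx'; have n0 := n_gt0R; have wl := window_length; split.
  have fwd y y' c : window a b y -> window a b y' -> shifted S c y y' ->
      chart a ts y = chart a ts y'.
    move=> Wy Wy' sh; rewrite /chart (shifted_phase sh); congr (_, _).
    case: sh => eh ew; have [_ hy] := Wy; have [_ hy'] := Wy'.
    (* No translation, the two ends of the window, or a translation longer than the window. *)
    case: c eh ew => [|[|c]] eh ew.
    - rewrite eh mul0n addr0; congr direction; apply/rowP => s.
      by rewrite -ew expg0 perm1.
    - have eh' : height y' = height y + n%:R by rewrite eh mul1n.
      have [_ _ ->] := chart_ends Wy Wy' eh'; try exact: window_weight.
      by move=> s; rewrite -ew expg1.
    - have : (2 * n)%:R <= (c.+2 * n)%:R :> R by rewrite ler_nat; apply: leq_mul.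
      by rewrite natrM => ?; exfalso; lra.
  move=> e; have [[t nt hx] _] := Wx; have [[t' nt' hx'] _] := Wx'.
  have [c [sh|sh]] := wrap_eq nt nt' hx hx' e; first exact: fwd sh.
  by apply/esym; apply: fwd sh.
have bwd y y' : window a b y -> window a b y' -> height y <= height y' ->
    chart a ts y = chart a ts y' -> wrap n y = wrap n y'.
  move=> Wy Wy' le e; have [ed ep] := (congr1 fst e, congr1 snd e); rewrite /= in ed ep.
  have [[t nt hy] hya] := Wy; have [[t' nt' hy'] hya'] := Wy'.
  case: (ltP (height y') (height y + n%:R)) => lt.
    have eh : height y = height y' by apply: phase_inj => //; rewrite le lt.
    congr wrap; apply: (strip_inj hy hy' _ eh).
    move: ed; rewrite -eh => /direction_inj -> //; try exact: window_weight.
    exact: window_time.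
  have eh' : height y' = height y + n%:R by lra.
  have [ea ea' ends] := chart_ends Wy Wy' eh'.
  move/ends: ed => /(_ (window_weight Wy) (window_weight Wy')) ew.
  have aN : a + (2 * n)%:R < N%:R by move: bN; rewrite !natrM; lra.
  (* [z] stands in for the translate of [y] by one period: having the height and the weights of
     [y'], it will be equal to [y']. *)
  have [u [z [nu hz wz hza]]] := strip_lift_exists (wrap_realization nt hy) na aN.
  rewrite -wz; congr wrap; apply: (strip_inj hz hy'); last first.
    have [c [[sh _]|[sh _]]] := wrap_eq nt nu hy hz (esym wz).
      case: c sh => [|[|c]] sh.
      - by move: sh; rewrite mul0n; lra.
      - by move: sh; rewrite mul1n; lra.
      - have : (2 * n)%:R <= (c.+2 * n)%:R :> R by rewrite ler_nat; apply: leq_mul.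
        by rewrite natrM => ?; exfalso; lra.
    by exfalso; have := ler0n R (c * n); lra.
  have [c [[sh ew']|[sh _]]] := wrap_eq nt nu hy hz (esym wz); last first.
    by exfalso; have := ler0n R (c * n); lra.
  have c1 : c = 1%N.
    case: c sh {ew'} => [|[|c]] sh //; first by exfalso; move: sh; rewrite mul0n; lra.
    have : (2 * n)%:R <= (c.+2 * n)%:R :> R by rewrite ler_nat; apply: leq_mul.
    by rewrite natrM => ?; exfalso; lra.
  apply/rowP => s; rewrite -(permKV mono s) ew; have := ew' ((mono^-1)%g s).
  by rewrite c1 expg1.
move=> e; case: (leP (height x) (height x')) => [le|/ltW le]; first exact: bwd.
by apply/esym/bwd.
Qed.

Lemma chart_image : chart a ts @` window a b =
  [set y | sphere R m y.1 /\ exists2 h, a <= h <= b & phase h = y.2].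
Proof.
apply/seteqP; split=> [_ [x Wx <-]|[y _] /= [hy [h hab <-]]].
  split=> /=; last by exists (height x) => //; case: Wx.
  by apply: direction_sphere (window_weight Wx) => //; apply: window_time; case: Wx.
have [l hl el] := direction_surj (window_time hab) ats hy.
have [||t [x [nt hx wx hgt]]] := @strip_surj R q n S N l h hl.
- by apply: le_trans na _; case/andP: hab.
- by have := n_gt0R; move: bN hab; rewrite natrM; lra.
exists x; first by split; [exists t | rewrite hgt].
by rewrite /chart wx hgt el.
Qed.

Lemma chart_homeomorphism : exists p : 'rV[R]_n -> 'rV[R]_m.+1 * 'rV[R]_2,
  homeomorphism (@wrap R n _ @` window a b) (chart a ts @` window a b) p /\
  forall x, window a b x -> p (wrap n x) = chart a ts x.
Proof.
apply: (@compact_quotients _ _ _ (window a b) (@wrap R n N) (chart a ts) 0).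
- by apply: window_compact; have := n_gt0R; move: bN; rewrite natrM; lra.
- exact: norm_hausdorff.
- exact: norm_hausdorff.
- by apply: continuous_subspaceT; exact: wrap_continuous.
- exact: chart_continuous.
- exact: wrap_chart.
Qed.

End Window.

End Chart.

(** [chart] puts the fibre first, whereas [fiber_bundle] expects the base first. *)
Lemma homeomorphism_swap (S T U : topologicalType) (A : set S) (B : set (T * U))
    (f : S -> T * U) :
  homeomorphism A B f ->
  homeomorphism A [set y | B (y.2, y.1)] (fun x => ((f x).2, (f x).1)).
Proof.
move=> [g [cf cg fg gf]]; exists (fun y => g (y.2, y.1)); split.
- move=> x; have cx := cf x.
  have c2 : {for x, continuous (fun y : subspace A => (f y).2)}.
    by apply: (@continuous_comp (subspace A) _ _ f snd) => //; exact: cvg_snd.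
  have c1 : {for x, continuous (fun y : subspace A => (f y).1)}.
    by apply: (@continuous_comp (subspace A) _ _ f fst) => //; exact: cvg_fst.
  exact: (cvg_pair c2 c1).
- apply/subspace_continuousP => y By W nW.
  move/subspace_continuousP : cg => /(_ (y.2, y.1) By W nW); rewrite /nbhs /=.
  have cs : (fun z : U * T => (z.2, z.1)) @ nbhs y --> nbhs (y.2, y.1).
    by apply: cvg_pair; [exact: cvg_snd | exact: cvg_fst].
  by move=> h; apply: cs h.
- by move=> x Ax /=; have [h e] := fg x Ax; rewrite -surjective_pairing.
- move=> [u t] /= Bx; have [h e] := gf _ Bx.
  by rewrite e.
Qed.

(** * The realization as a product, and as a sphere bundle *)

Section Bundle.
Variables (R : realType) (m n : nat).
Local Notation q := m.+2.
Variable S : scheme q n.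
Local Notation N := (8 * n)%N.
Local Notation K := (strip_complex S).
Local Notation wrap := (@wrap R n N).

Lemma wrap_image (a b : R) : b = a + n%:R -> (2 * n)%:R <= a -> a + (2 * n)%:R < N%:R ->
  wrap @` window S a b = realization R K.
Proof.
move=> -> na aN; apply/seteqP; split=> [_ [x [[t nt hx] _] <-]|z hz].
  exact: wrap_realization hx.
have [t [x [nt hx wx /andP[h1 h2]]]] := strip_lift_exists hz na aN.
by exists x => //; split; [exists t | rewrite (ltW h1)].
Qed.

Lemma strip_complex_homeomorphic : ~~ odd_perm (mono S) ->
  homeomorphic (realization R K) (sphere R m `*` sphere R 1).
Proof.
move=> even; have n0 := n_gt0R R S.
have [ts e ats] := prod_tpermP (mono S).
have evts : ~~ odd (size ts) by rewrite -(odd_perm_prod ats) -e.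
pose a : R := (2 * n)%:R; pose b : R := a + n%:R.
have na : (2 * n)%:R <= a by [].
have bN : b + (3 * n)%:R < N%:R by rewrite /b /a !natrM; lra.
have triv : monodromy_trivialized S a b ts.
  right; split=> // v; split=> [|s]; first exact: isotopy0.
  by rewrite isotopy1 // e.
have [p [hp _]] := chart_homeomorphism ats na bN triv.
exists p; move: hp; rewrite wrap_image //; last by move: bN; rewrite /b !natrM; lra.
rewrite (chart_image ats na bN triv).
congr homeomorphism; apply/seteqP; split=> -[u v] /= [hu hv]; split=> //=.
  by case: hv => h _ <-; apply: phase_sphere.
have [h /andP[h1 h2] <-] := phase_surj S 2 hv.
by exists h => //; rewrite h1 ltW.
Qed.

Lemma phase_surj_real (y : 'rV[R]_2) (a : R) : 0 <= a -> sphere R 1 y ->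
  exists2 h, a < h <= a + n%:R & phase n h = y.
Proof.
move=> a0 /(phase_surj S 0); rewrite mul0n add0r => -[h /andP[h0 hn] <-].
have n0 := n_gt0R R S.
have y0 : 0 <= (a + n%:R - h) / n%:R by apply: divr_ge0; lra.
have /andP[cy yc] := truncn_itv y0; move: cy yc.
set c := Num.truncn _; rewrite ler_pdivlMr // ltr_pdivrMr // -natr1 mulrDl mul1r => cy yc.
exists (h + (c * n)%:R); last exact: (phaseD S).
by rewrite natrM; apply/andP; split; lra.
Qed.

Definition phase_dot (y y' : 'rV[R]_2) : R := y 0 0 * y' 0 0 + y 0 1 * y' 0 1.

Lemma phase_dot_continuous c : continuous (fun y => phase_dot y c).
Proof.
move=> y; have cc i : {for y, continuous (fun y : 'rV[R]_2 => y 0 i * c 0 i)}.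
  apply: continuousM; first exact: coord_continuous.
  exact: cst_continuous.
exact: (continuousD (cc 0) (cc 1)).
Qed.

(** The dot product is the cosine of [2 pi (h' - h) / n], nonpositive when the heights differ by
    between a quarter and a half period. *)
Lemma phase_near (h h' : R) : - (n%:R / 2) <= h' - h <= n%:R / 2 ->
  0 < phase_dot (phase n h') (phase n h) -> - (n%:R / 4) <= h' - h <= n%:R / 4.
Proof.
have n0 := n_gt0R R S; have p0 := pi_gt0 R.
rewrite /phase_dot angle_dot -mulrBl; set d := h' - h.
pose w : R := pi *+ 2 / n%:R; rewrite -/w.
have w0 : 0 < w by apply: divr_gt0 => //; rewrite mulr2n; lra.
have wn : n%:R * w = 2 * pi by rewrite /w mulrC divfK ?gt_eqF // mulr_natl.
have far e : n%:R / 4 < e -> e <= n%:R / 2 -> cos (e * w) <= 0.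
  move=> e1 e2; have -> : e * w = (e * w - pi / 2) + pi / 2 by ring.
  rewrite cosDpihalf oppr_le0; apply: sin_ge0_pi.
  have := ler_wpM2r (ltW w0) (ltW e1); have := ler_wpM2r (ltW w0) e2.
  have -> : n%:R / 2 * w = pi by rewrite mulrAC wn; field.
  have -> : n%:R / 4 * w = pi / 2 by rewrite mulrAC wn; field.
  by move=> h1 h2; apply/andP; split; lra.
move=> /andP[d1 d2] c0; apply/andP; split; rewrite leNgt; apply/negP => lt.
  have h1 : n%:R / 4 < - d by lra.
  have h2 : - d <= n%:R / 2 by lra.
  by have := far _ h1 h2; rewrite mulNr cosN leNgt c0.
by have := far d lt d2; rewrite leNgt c0.
Qed.

(** The projection is the phase of the height, which is invariant under translation by a period and
    so descends to the quotient. *)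
Lemma strip_complex_bundle : sphere_bundle_over_circle R m (realization R K).
Proof.
have n0 := n_gt0R R S.
pose X := window S (2 * n)%:R ((2 * n)%:R + n%:R) : set 'rV[R]_N.
have wX : wrap @` X = realization R K.
  by apply: wrap_image; rewrite // !natrM; lra.
have [p [cp pX]] : exists p : 'rV[R]_n -> 'rV[R]_2, {within wrap @` X, continuous p} /\
    forall x, X x -> p (wrap x) = phase n (height x).
  apply: (@compact_factor _ _ _ X wrap (fun x => phase n (height x)) 0).
  - by apply: window_compact; rewrite !natrM; lra.
  - exact: norm_hausdorff.
  - by apply: continuous_subspaceT; exact: wrap_continuous.
  - apply: continuous_subspaceT => x.
    apply: (@continuous_comp _ _ _ (@height R N) (phase n)); first exact: height_continuous.
    exact: phase_continuous.
  - move=> x x' [[t nt hx] _] [[t' nt' hx'] _] e.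
    by have [c [sh|sh]] := wrap_eq nt nt' hx hx' e; rewrite (shifted_phase sh).
have pE t x : (n <= t)%N -> strip S t x -> p (wrap x) = phase n (height x).
  move=> nt hx; have : realization R K (wrap x) by apply: wrap_realization hx.
  rewrite -wX => -[x' Xx' e]; rewrite -e pX //; case: Xx' => -[t' nt' hx'] _.
  by have [c [sh|sh]] := wrap_eq nt' nt hx' hx e; rewrite (shifted_phase sh).
exists p; split.
- by rewrite -wX.
- move=> z; rewrite -wX => -[x Xx <-]; rewrite pX //; exact: phase_sphere.
move=> _ /(phase_surj S 3)[h /andP[h3 h4] <-].
(* The open half circle around [phase n h]: by [phase_near] its points have lifts within a quarter
   period of [h]. The window has length [n / 2], so the monodromy does not enter and the isotopy is
   constant. *)
pose U := [set y : 'rV[R]_2 | 0 < phase_dot y (phase n h)].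
pose a := h - n%:R / 4; pose b := h + n%:R / 4.
have na : (2 * n)%:R <= a by move: h3; rewrite /a !natrM; lra.
have bN : b + (3 * n)%:R < N%:R by move: h4; rewrite /b !natrM; lra.
have triv : monodromy_trivialized S a b [::] by left; rewrite /a /b; lra.
have ats : all perm.dpair ([::] : seq ('I_q * 'I_q)) by [].
have [g [hg gE]] := chart_homeomorphism ats na bN triv.
rewrite (chart_image ats na bN triv) in hg.
have {hg} hg := homeomorphism_swap hg.
exists U; split.
- apply: (@open_comp _ _ (fun y => phase_dot y (phase n h)) [set r | 0 < r]).
    by move=> y _; exact: phase_dot_continuous.
  exact: open_gt.
- rewrite /U /= /phase_dot -!expr2; have /sphere1E -> := phase_sphere n h.
  exact: ltr01.
exists (fun z => ((g z).2, (g z).1)).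
  (* The chart lives over a closed half circle, whose two ends are not in [U]; both sides are cut
     down to [U]. *)
  apply: (homeomorphism_restrict hg).
  - move=> z /= [hz Uz]; have [||t [x [nt hx wx hgt]]] := @strip_lift_exists R q n S N z (h - n%:R / 2) hz.
    + by move: h3; rewrite !natrM; lra.
    + by move: h4; rewrite !natrM; lra.
    exists x => //; split; first by exists t.
    move: Uz; rewrite /U /= -wx (pE t) // => Uz.
    by have := phase_near _ Uz; rewrite /a /b; move: hgt => /andP[? ?]; lra.
  - move=> [u v] /= [[hu Uu] hv]; split=> //.
    have [|h' /andP[h1 h2] e] := @phase_surj_real u (h - n%:R / 2) _ hu.
      by move: h3; rewrite !natrM; lra.
    exists h' => //; rewrite /U /= -e in Uu.
    by have := phase_near _ Uu; rewrite /a /b; lra.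
  - move=> _ [x Wx <-]; rewrite gE //=; have [[t nt hx] hh] := Wx.
    have e := pE _ _ nt hx; rewrite e; split=> [[_ hU]|[[_ hU] _]]; split=> //=.
    + by split=> //; apply: phase_sphere.
    + apply: direction_sphere (strip_weight hx) => //.
      exact: (window_time triv).
    + exact: wrap_realization hx.
move=> z hz Uz.
have [||t [x [nt hx wx hgt]]] := @strip_lift_exists R q n S N z (h - n%:R / 2) hz.
- by move: h3; rewrite !natrM; lra.
- by move: h4; rewrite !natrM; lra.
have Wx : window S a b x.
  split; first by exists t.
  move: Uz; rewrite /U /= -wx (pE t) // => Uz.
  by have := phase_near _ Uz; rewrite /a /b; move: hgt => /andP[? ?]; lra.
by rewrite -wx gE // (pE t).
Qed.

End Bundle.

(** * The sign of a vertex ordering and simplicial orientations *)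

Section OrderSign.
Variables (q n : nat).
Implicit Types p : 'I_q -> 'I_n.

(** For injective [p], the sign of the permutation sorting its values. The determinant makes it
    alternating, and the Vandermonde product expresses it by comparisons. *)
Definition order_sign p : int :=
  Num.sg (\det (Vandermonde q (\row_i (p i)%:Z))).

Lemma order_sign_perm p (s : 'S_q) :
  order_sign (p \o s) = (-1) ^+ s * order_sign p.
Proof.
rewrite /order_sign.
have -> : Vandermonde q (\row_i ((p \o s) i)%:Z) = col_perm s (Vandermonde q (\row_i (p i)%:Z)).
  by apply/matrixP => i j; rewrite !mxE.
rewrite col_permE det_mulmx det_perm odd_permV sgrM mulrC; congr (_ * _).
by case: (odd_perm s); rewrite ?expr1 ?expr0 ?sgrN1 ?sgr1.
Qed.

Lemma order_signE p : order_sign p =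
  \prod_(i < q) \prod_(j < q | (i < j)%N) Num.sg ((p j)%:Z - (p i)%:Z).
Proof.
rewrite /order_sign det_Vandermonde.
have sg_prod I (r : seq I) (P : pred I) (F : I -> int) :
    Num.sg (\prod_(i <- r | P i) F i) = \prod_(i <- r | P i) Num.sg (F i).
  by apply: (big_morph _ _ (sgr1 _)) => x y; rewrite sgrM.
rewrite sg_prod; apply: eq_bigr => i _; rewrite sg_prod.
by apply: eq_bigr => j _; rewrite !mxE.
Qed.

Lemma order_sign_neq0 p : injective p -> order_sign p != 0.
Proof.
move=> pinj; rewrite order_signE; apply/prodf_neq0 => i _; apply/prodf_neq0 => j ij.
rewrite sgr_eq0 subr_eq0; apply/negP => /eqP [] /val_inj/pinj e.
by rewrite e ltnn in ij.
Qed.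

End OrderSign.

Definition order_sign_tail q n (p : 'I_q.+1 -> 'I_n) : int :=
  \prod_(i < q) \prod_(j < q.+1 | (lift ord0 i < j)%N)
    Num.sg ((p j)%:Z - (p (lift ord0 i))%:Z).

Lemma order_sign_recl q n (p : 'I_q.+1 -> 'I_n) : injective p ->
  order_sign p = (-1) ^+ #|[set x in [set p i | i in 'I_q.+1] | (x < p ord0)%N]%SET|
    * order_sign_tail p.
Proof.
move=> pinj; rewrite order_signE big_ord_recl; congr (_ * _).
have -> : #|[set x in [set p i | i in 'I_q.+1] | (x < p ord0)%N]%SET| =
    (\sum_(j < q.+1 | (0 < j)%N) (p j < p ord0))%N.
  have -> : [set x in [set p i | i in 'I_q.+1] | (x < p ord0)%N]%SET =
      [set p i | i in [set j : 'I_q.+1 | (p j < p ord0)%N]]%SET.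
    apply/setP => x; rewrite inE; apply/andP/imsetP.
      by move=> [/imsetP[i _ ->] lt]; exists i; rewrite ?inE.
    by move=> [i + ->]; rewrite inE => lt; split=> //; apply/imsetP; exists i.
  rewrite card_imset // -sum1dep_card big_mkcond [RHS]big_mkcond /=.
  apply: eq_bigr => j _; case: (ltnP 0 j) => [_|j0]; first by case: ifP.
  have -> : j = ord0 by apply: val_inj => /=; case: (val j) j0.
  by rewrite ltnn.
elim/big_rec2: _ => [|j k x j0 ->]; first by rewrite expr0.
rewrite exprD; congr (_ * _).
case: (ltngtP (p j) (p ord0)) => [lt|lt|/val_inj/pinj e] /=.
- by rewrite expr1; apply: ltr0_sg; rewrite subr_lt0 ltz_nat.
- by rewrite expr0; apply: gtr0_sg; rewrite subr_gt0 ltz_nat.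
- by rewrite e in j0.
Qed.

Lemma order_sign_flip q n (K : {set {set 'I_n}}) (eps : {set 'I_n} -> bool)
    (p p' : 'I_q -> 'I_n) (k : 'I_q) :
  (forall (s t : {set 'I_n}) (a b : 'I_n),
      facet K s -> facet K t -> s <> t -> a \in s -> b \in t ->
      (s :\ a = t :\ b)%SET ->
      induced_sign eps s a = - induced_sign eps t b) ->
  injective p -> injective p' -> (forall i, i != k -> p i = p' i) ->
  facet K [set p i | i in 'I_q]%SET -> facet K [set p' i | i in 'I_q]%SET ->
  [set p i | i in 'I_q]%SET <> [set p' i | i in 'I_q]%SET ->
  (-1) ^+ eps [set p i | i in 'I_q]%SET * order_sign p =
  - ((-1) ^+ eps [set p' i | i in 'I_q]%SET * order_sign p').
Proof.
case: q p p' k => [|q] p p' k; first by case: k.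
(* Moving [k] to the first position by a transposition changes both order signs by the same
   factor. *)
move=> ori; wlog k0 : p p' k / k = ord0.
  move=> W pinj pinj' agree fp fp' ne; pose s := tperm k ord0.
  have im (f : 'I_q.+1 -> 'I_n) : [set (f \o s) i | i in 'I_q.+1]%SET = [set f i | i in 'I_q.+1]%SET.
    apply/setP => x; apply/imsetP/imsetP => -[i _ ->].
      by exists (s i).
    by exists (s i) => //=; rewrite tpermK.
  have := W (p \o s) (p' \o s) ord0 erefl; rewrite !im !order_sign_perm.
  rewrite !mulrA ![_ * (-1) ^+ s]mulrC -!mulrA -mulrN => H.
  apply: (mulfI (negbT (signr_eq0 _ s))); apply: H => //.
  - by apply: inj_comp => //; apply: perm_inj.
  - by apply: inj_comp => //; apply: perm_inj.
  - move=> i i0 /=; apply: agree; rewrite /s; apply: contraNneq i0 => e.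
    by rewrite -(tpermK k ord0 i) e tpermL.
rewrite k0 => pinj pinj' agree fp fp' ne.
have tail : order_sign_tail p = order_sign_tail p'.
  apply: eq_bigr => i _; apply: eq_bigr => j ij.
  by rewrite !agree // -val_eqE /=; case: (val j) ij.
have := ori _ _ (p ord0) (p' ord0) fp fp' ne.
rewrite /induced_sign !order_sign_recl // tail !mulrA => -> //.
- by rewrite mulNr.
- by apply/imsetP; exists ord0.
- by apply/imsetP; exists ord0.
have rest (f : 'I_q.+1 -> 'I_n) : injective f ->
    ([set f i | i in 'I_q.+1] :\ f ord0 = [set f (lift ord0 i) | i in 'I_q])%SET.
  move=> finj; apply/setP => x; rewrite !inE; apply/andP/imsetP.
    move=> [x0 /imsetP[i _ e]]; case: (unliftP ord0 i) e => [i' ->|->] e.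
      by exists i'.
    by rewrite e eqxx in x0.
  move=> [i _ ->]; split; last by apply/imsetP; exists (lift ord0 i).
  by rewrite (inj_eq finj) eq_sym neq_lift.
by rewrite !rest //; apply: eq_imset => i; rewrite agree.
Qed.

(** * Orientation carried along the strip, and nonorientability *)

Section Orientation.
Variables (q n : nat) (S : scheme q n).
Local Notation slot := (slot S).
Local Notation mono := (mono S).
Local Notation live := (live S).
Local Notation unwrap := (unwrap n).
Local Notation last := (last S).
Local Notation star := (star S).
Local Notation K := (strip_complex S).

Definition residue (i : nat) : 'I_n := Ordinal (ltn_pmod i (n_gt0 S)).

(* The vertices of a cell born at time t.+1, indexed by slots: the missing slot
   j holds the new vertex. *)
Definition cell_vertex t (j s : 'I_q) : nat := if s == j then t.+1 else last t s.

Definition cell_map t j (s : 'I_q) : 'I_n := residue (cell_vertex t j s).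

Lemma last_eq t s i : (q < t)%N -> (i <= t)%N -> slot i = s ->
  (forall u, (i < u <= t)%N -> slot u != s) -> last t s = i.
Proof.
move=> qt it si nu; apply/eqP; rewrite eqn_leq; apply/andP; split.
  rewrite leqNgt; apply/negP => lt; have := nu (last t s).
  by rewrite lt last_le => /(_ isT); rewrite slot_last_window ?eqxx.
rewrite leqNgt; apply/negP => lt; have := @last_max _ _ S t s i.
by rewrite lt it si eqxx => /(_ isT).
Qed.

Lemma last_shift t s : (q < t)%N -> last (t + n) (mono s) = (last t s + n)%N.
Proof.
move=> qt; apply: last_eq; first by rewrite (leq_trans qt) // leq_addr.
- by rewrite leq_add2r last_le.
- by rewrite slot_shift slot_last_window.
move=> u /andP[h1 h2]; have nu : (n <= u)%N.
  by apply: leq_trans (ltnW h1); rewrite leq_addl.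
rewrite -(subnK nu) slot_shift (inj_eq perm_inj); apply: (@last_max _ _ S t).
by rewrite ltn_subRL addnC h1 leq_subLR addnC.
Qed.

Lemma cell_map_shift t j s : (q < t)%N ->
  cell_map (t + n) (mono j) (mono s) = cell_map t j s.
Proof.
move=> qt; apply: val_inj => /=; rewrite /cell_vertex (inj_eq perm_inj).
by case: ifP => _; rewrite ?last_shift // -?addSn modnDr.
Qed.

Lemma live_cell_vertex t j s : (q < t)%N -> live t.+1 (cell_vertex t j s).
Proof.
move=> qt; rewrite /cell_vertex; case: ifP => _; last exact: live_lastS.
by apply/liveP; split=> // u /andP[h1 h2]; rewrite ltnNge ltnW in h2.
Qed.

Lemma residue_inj t i i' : (n <= t)%N -> live t i -> live t i' ->
  residue i = residue i' -> i = i'.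
Proof.
move=> nt li li' /(congr1 val) /= e.
by rewrite (live_unwrap nt li) (live_unwrap nt li') e.
Qed.

Lemma cell_vertex_inj t j : (q < t)%N -> injective (cell_vertex t j).
Proof.
move=> qt s s'; rewrite /cell_vertex.
case: eqP => [->|_]; case: eqP => [->|_] // e.
- by have := last_le S t s'; rewrite -e ltnn.
- by have := last_le S t s; rewrite e ltnn.
- by rewrite -(slot_last_window S s qt) e slot_last_window.
Qed.

Lemma q_lt_n : (q < n)%N. Proof. by rewrite (size_eq S); lia. Qed.

Lemma cell_map_inj t j : (n <= t)%N -> injective (cell_map t j).
Proof.
move=> nt s s' e; have qt : (q < t)%N := leq_trans q_lt_n nt.
apply: (cell_vertex_inj qt); apply: residue_inj e; first exact: leqW nt.
  exact: live_cell_vertex.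
exact: live_cell_vertex.
Qed.

Lemma star_residue t j i : (n <= t)%N -> live t i ->
  (residue i \in star t j) = (slot i != j).
Proof. by move=> nt li; rewrite inE /= -(live_unwrap nt li) li. Qed.

Lemma star_sub_cell t j : (n <= t)%N ->
  star t.+1 j \subset [set cell_map t j s | s in 'I_q]%SET.
Proof.
move=> nt; have qt : (q < t)%N := leq_trans q_lt_n nt.
apply/fintype.subsetP => r; rewrite inE => /andP[li sj]; apply/imsetP.
have nt1 : (n <= t.+1)%N := leqW nt.
have er : r = residue (unwrap t.+1 r).
  by apply: val_inj; rewrite /= (unwrap_mod S) // modn_small.
move: li sj er; set i := unwrap t.+1 r => li sj er.
case: (eqVneq i t.+1) => [it|it].
  by exists j => //; rewrite er /cell_map /cell_vertex eqxx it.
exists (slot i) => //; rewrite er /cell_map /cell_vertex (negbTE sj).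
have [it1 hu] := elimT (liveP _ _ _) li.
congr residue; apply/esym/last_eq => //.
by rewrite -ltnS ltn_neqAle it.
Qed.

Lemma star_cell t j : (n <= t)%N -> j != slot t.+1 ->
  star t.+1 j = [set cell_map t j s | s in 'I_q]%SET.
Proof.
move=> nt js; have qt : (q < t)%N := leq_trans q_lt_n nt.
apply/eqP; rewrite finset.eqEsubset star_sub_cell //=; apply/fintype.subsetP => _ /imsetP[s _ ->].
rewrite star_residue ?live_cell_vertex ?(leqW nt) // /cell_vertex.
case: (eqVneq s j) => [_|sj]; first by rewrite eq_sym.
by rewrite slot_last_window.
Qed.

Lemma star_card t j : (n < t)%N -> (#|star t j| <= q)%N.
Proof.
case: t => // t nt; rewrite (leq_trans (subset_leq_card (star_sub_cell j nt))) //.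
by rewrite (leq_trans (leq_imset_card _ _)) // card_ord.
Qed.

Lemma star_facet t j : (n <= t)%N -> j != slot t.+1 -> facet K (star t.+1 j).
Proof.
move=> nt js; split.
  apply/strip_complexP; split; last by exists t.+1, j; split=> //; exact: leqW.
  rewrite star_cell //; apply/finset.set0Pn; exists (cell_map t j j).
  by apply/imsetP; exists j.
move=> F /strip_complexP[_ [u [j' [nu Fu]]]] sF; apply/esym/eqP.
rewrite eqEcard sF /= (leq_trans (subset_leq_card Fu)) //.
(* [star_card] asks for a time beyond [n]; moving on by a period covers [u = n]. *)
rewrite -(star_shift S j' nu) (leq_trans (star_card _ _)) //.
  by rewrite -addn1 leq_add ?(n_gt0 S).
by rewrite star_cell // card_imset ?card_ord //; apply: cell_map_inj.
Qed.

Section Coherent.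
Variable eps : {set 'I_n} -> bool.
Hypothesis coherent : forall (s t : {set 'I_n}) (a b : 'I_n),
  facet K s -> facet K t -> s <> t -> a \in s -> b \in t ->
  (s :\ a = t :\ b)%SET -> induced_sign eps s a = - induced_sign eps t b.

(** Compares the orientation given by [eps] with the one given by the order of the slots. *)
Definition orientation t j : int :=
  (-1) ^+ eps (star t.+1 j) * order_sign (cell_map t j).

Lemma orientation_neq0 t j : (n <= t)%N -> orientation t j != 0.
Proof.
move=> nt; rewrite mulf_eq0 signr_eq0 /= order_sign_neq0 //.
exact: cell_map_inj.
Qed.

(* Exchanging the vertices in two slots makes the maps of two adjacent cells
   agree off one slot; the two sign changes cancel. *)
Lemma orientation_adjacent t j t' j' (a b k : 'I_q) : (n <= t)%N -> (n <= t')%N ->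
  j != slot t.+1 -> j' != slot t'.+1 -> a != b ->
  star t.+1 j <> star t'.+1 j' ->
  (forall s, s != k -> cell_map t j s = cell_map t' j' (tperm a b s)) ->
  orientation t j = orientation t' j'.
Proof.
move=> nt nt' js js' ab ne agree.
have im : [set (cell_map t' j' \o tperm a b) s | s in 'I_q]%SET = star t'.+1 j'.
  rewrite star_cell //; apply/setP => x; apply/imsetP/imsetP => -[s _ ->].
    by exists (tperm a b s).
  by exists (tperm a b s) => //=; rewrite tpermK.
have := @order_sign_flip _ _ K eps (cell_map t j) (cell_map t' j' \o tperm a b) k coherent.
rewrite im -star_cell // order_sign_perm odd_tperm ab expr1 mulN1r mulrN opprK; apply => //.
- exact: cell_map_inj.
- by apply: inj_comp; [apply: cell_map_inj | apply: perm_inj].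
- exact: star_facet.
- exact: star_facet.
Qed.

(** Exchanging [j] and [j'] puts the new vertex in the same position for both cells, so that they
    differ at [j'] only. *)
Lemma orientation_slot t j j' : (n <= t)%N -> j != slot t.+1 -> j' != slot t.+1 ->
  orientation t j = orientation t j'.
Proof.
move=> nt js js'; case: (eqVneq j j') => [->//|jj'].
have qt : (q < t)%N := leq_trans q_lt_n nt.
apply: (@orientation_adjacent t j t j' j j' j') => //.
  move=> e; have := star_residue j' (leqW nt) (live_lastS S j' qt).
  rewrite -e star_residue ?(leqW nt) ?live_lastS // slot_last_window //.
  by rewrite eqxx eq_sym jj'.
move=> s sj'; congr residue; rewrite /cell_vertex.
case: tpermP => [->|e|/eqP/negbTE -> /eqP/negbTE -> //].
- by rewrite !eqxx.
- by rewrite e eqxx in sj'.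
Qed.

(** After an exchange of [j] with the slot of [t + 1], the two cells differ only in that the vertex
    replaced at time [t + 1] gives way to [t + 2]. *)
Lemma orientation_step t j : (n <= t)%N -> j != slot t.+1 -> j != slot t.+2 ->
  orientation t j = orientation t.+1 j.
Proof.
move=> nt js js'; have qt : (q < t)%N := leq_trans q_lt_n nt.
apply: (@orientation_adjacent t j t.+1 j j (slot t.+1) (slot t.+1)) => //; first exact: leqW.
  (* The residue of [t + 2] could occur in the earlier cell only through [t + 2] minus some periods,
     which is too old to be live at [t + 1]. *)
  move=> e; have lt2 : live t.+2 t.+2.
    by apply/liveP; split=> // u /andP[h1 h2]; rewrite ltnNge ltnW in h2.
  have := star_residue j (leqW (leqW nt)) lt2.
  rewrite -e eq_sym js' inE => /andP[li _]; have := live_range li; have := live_le li.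
  have := size_eq S; have := unwrap_range S (residue t.+2) (leqW nt).
  have : unwrap t.+1 (residue t.+2) = t.+2 %[mod n].
    by rewrite (unwrap_mod S) ?(leqW nt) // /residue /= modn_mod.
  set u := unwrap _ _ => eu hu en h1 h2.
  have : (t.+2 == u %[mod n]) by rewrite eu.
  rewrite eqn_mod_dvd; last by clear -h1; lia.
  move=> /dvdnP[c hc]; case: c hc => [|c] hc; first by clear -hc h1; lia.
  have cn := leq_pmull n (ltn0Sn c); have q0 : (0 < q)%N := leq_ltn_trans (leq0n j) (ltn_ord j).
  by clear -hc h2 en cn q0; lia.
move=> s sa; congr residue; rewrite /cell_vertex /= .
case: tpermP => [->|e|/eqP sj /eqP/negbTE sa'].
- by rewrite eqxx eq_sym (negbTE js) eqxx.
- by rewrite e eqxx in sa.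
- by rewrite (negbTE sj) eq_sym sa'.
Qed.

Lemma orientation_shift t j : (n <= t)%N ->
  orientation t j = (-1) ^+ mono * orientation (t + n) (mono j).
Proof.
move=> nt; have qt : (q < t)%N := leq_trans q_lt_n nt.
rewrite /orientation -addSn star_shift ?(leqW nt) // mulrCA -order_sign_perm.
congr (_ * order_sign _); apply/funext => s.
by rewrite /comp cell_map_shift.
Qed.

Lemma orientation_const t d j j' : (2 < q)%N -> (n <= t)%N ->
  j != slot t.+1 -> j' != slot (t + d).+1 ->
  orientation t j = orientation (t + d) j'.
Proof.
move=> q2 nt; elim: d j' => [|d IH] j' js js'.
  by rewrite addn0 in js' *; apply: orientation_slot.
(* With three slots, one is refilled at neither of two consecutive times, and the cells omitting it
   link these times. *)
have [c /andP[c1 c2]] : exists c, (c != slot (t + d).+1) && (c != slot (t + d).+2).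
  apply: contrapT => none.
  have : (#|'I_q| <= #|[set slot (t + d).+1; slot (t + d).+2]%SET|)%N.
    apply: subset_leq_card; apply/fintype.subsetP => c _; rewrite !inE.
    by apply/negPn/negP; rewrite negb_or => h; apply: none; exists c.
  by rewrite card_ord cards2 leqNgt (leq_trans _ q2) // ltnS; case: (_ != _).
have ntd : (n <= t + d)%N by rewrite (leq_trans nt) // leq_addr.
rewrite (IH c) // orientation_step // addnS; rewrite addnS in js'.
by apply: orientation_slot => //; apply: leqW.
Qed.

End Coherent.

(** A cell and its translate by a period are the same simplex. Transport along the strip gives them
    equal signs, the odd relabelling of slots opposite ones, and the sign is not zero. *)
Lemma strip_complex_nonorientable : (2 < q)%N -> odd_perm mono -> ~ orientable K.
Proof.
move=> q2 odd [eps coherent].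
have [j js] : exists j, j != slot n.+1.
  have q0 : (0 < q)%N by apply: leq_trans q2.
  have q1 : (1 < q)%N by apply: leq_trans q2.
  case: (eqVneq (slot n.+1) (Ordinal q0)) => [->|h].
    by exists (Ordinal q1).
  by exists (Ordinal q0); rewrite eq_sym.
have e := orientation_shift eps j (leqnn n).
have js' : mono j != slot (n + n).+1 by rewrite -addSn slot_shift (inj_eq perm_inj).
have e' := orientation_const coherent q2 (leqnn n) js js'.
have := orientation_neq0 eps j (leqnn n); rewrite odd expr1 mulN1r -e' in e.
by move/eqP: e; rewrite -addr_eq0 -mulr2n mulrn_eq0 /= => ->.
Qed.

End Orientation.

(** * Cyclic replacement patterns, with or without an exchange *)

Section CyclicScheme.
Variables (q n : nat) (swap : bool).
Hypotheses (q3 : (3 < q)%N) (en : n = (2 * q + 2)%N).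

Let q_gt0 : (0 < q)%N := leq_trans (isT : (0 < 4)%N) q3.
Let q_gt1 : (1 < q)%N := leq_trans (isT : (1 < 4)%N) q3.

Definition rotation : 'S_q := perm (can_inj (@ordSK q)).

(* Advancing the cyclic order by n = 2 q + 2 steps is a rotation by two, which
   is an even permutation; the optional transposition makes it odd. *)
Definition monodromy : 'S_q :=
  ((if swap then tperm (Ordinal q_gt0) (Ordinal q_gt1) else 1) * (rotation * rotation))%g.

Definition slot_at (i : nat) : 'I_q :=
  (monodromy ^+ (i %/ n))%g (Ordinal (ltn_pmod (i %% n) q_gt0)).

Lemma odd_monodromy : odd_perm monodromy = swap.
Proof.
rewrite /monodromy !odd_permM addbb addbF; case: swap; last exact: odd_perm1.
by rewrite odd_tperm.
Qed.

Lemma monodromy_val (e : 'I_q) : val (monodromy e) =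
  (if swap && (e == 0 :> nat) then 3 else
   if swap && (e == 1 :> nat) then 2 else (e + 2) %% q)%N.
Proof.
have rot2 (f : 'I_q) : val ((rotation * rotation)%g f) = ((f + 2) %% q)%N.
  by rewrite permM !permE /= -[X in (X %% q)%N = _]addn1 modnDml addn1 addn2.
rewrite /monodromy permM rot2; case: swap => /=; last by rewrite perm1.
case: tpermP => [->|->|/eqP h0 /eqP h1] /=.
- by rewrite modn_small.
- by rewrite modn_small // (leq_trans _ q3).
- by rewrite -!val_eqE /= in h0 h1; rewrite (negbTE h0) (negbTE h1).
Qed.

Lemma slot_at_low i : (i < n)%N -> val (slot_at i) = (i %% q)%N.
Proof. by move=> lt; rewrite /slot_at divn_small // expg0 perm1 /= (modn_small lt). Qed.

Lemma slot_at_shift c i : slot_at (i + c * n) = (monodromy ^+ c)%g (slot_at i).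
Proof.
have n0 : (0 < n)%N by rewrite en addn2.
rewrite /slot_at divnDMl // expgD permM; congr (fun_of_perm _ (fun_of_perm _ _)).
by apply: val_inj; rewrite /= addnC modnMDl.
Qed.

Lemma slot_at_high e : (e < q)%N -> val (slot_at (n + e)) =
  (if swap && (e == 0) then 3 else if swap && (e == 1) then 2 else (e + 2) %% q)%N.
Proof.
move=> eq; have e_n : (e < n)%N by rewrite en; lia.
have := slot_at_shift 1 e; rewrite mul1n addnC expg1 => ->.
by rewrite monodromy_val slot_at_low // modn_small.
Qed.

Lemma mod_addM k s : (s < q)%N -> ((s + k * q) %% q)%N = s.
Proof. by move=> sq; rewrite addnC modnMDl modn_small. Qed.

(** Inside the period slot [s] recurs at [s + k * q]. Past its end the order goes on as
    [2, 3, 4, ...], or as [3, 2, 4, ...] with the exchange; a window of [q + 1] labels absorbs the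
    delay of slot 2. *)
Lemma slot_at_window0 r (s : 'I_q) : (r < n)%N ->
  exists2 i, (r <= i <= r + q)%N & slot_at i = s.
Proof.
rewrite en => rn; have sq := ltn_ord s.
have low k : (r <= s + k * q <= r + q)%N -> (s + k * q < n)%N ->
    exists2 i, (r <= i <= r + q)%N & slot_at i = s.
  move=> h1 h2; exists (s + k * q)%N => //; apply: val_inj.
  by rewrite slot_at_low // mod_addM.
have high e : (r <= n + e <= r + q)%N -> (e < q)%N ->
    (if swap && (e == 0) then 3 else if swap && (e == 1) then 2 else (e + 2) %% q)%N = s ->
    exists2 i, (r <= i <= r + q)%N & slot_at i = s.
  move=> h1 h2 h3; exists (n + e)%N => //; apply: val_inj.
  by rewrite slot_at_high.
case: (leqP r s) => h0; first by apply: (low 0); lia.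
case: (leqP r (s + q)) => h1; first by apply: (low 1); lia.
case: (leqP r (s + 2 * q)) => h2.
  case: (ltnP s 2) => s2; first by apply: (low 2); lia.
  case: (boolP (swap && ((s == 2 :> nat) || (s == 3 :> nat)))) => [/andP[sw /orP[/eqP e|/eqP e]]|ns].
  - by apply: (high 1); rewrite ?sw ?e //; lia.
  - by apply: (high 0); rewrite ?sw ?e //; lia.
  - apply: (high (s - 2)%N); [lia | lia |].
    have -> : (swap && (s - 2 == 0)%N) = false.
      by apply: contraNF ns => /andP[-> ?] /=; lia.
    have -> : (swap && (s - 2 == 1)%N) = false.
      by apply: contraNF ns => /andP[-> ?] /=; lia.
    by rewrite subnK // modn_small.
have e0 : s = 0 :> nat by lia.
apply: (high (q - 2)%N); [lia | lia |].
have -> : (q - 2 == 0)%N = false by lia.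
have -> : (q - 2 == 1)%N = false by lia.
by rewrite !andbF subnK ?modnn // ltnW.
Qed.

Lemma slot_at_window t s : exists2 i, (t <= i <= t + q)%N & slot_at i = s.
Proof.
have n0 : (0 < n)%N by rewrite en addn2.
have [i hi si] := slot_at_window0 ((monodromy ^+ (t %/ n))^-1 s)%g (ltn_pmod t n0).
exists (i + t %/ n * n)%N; last by rewrite slot_at_shift si permKV.
by have := divn_eq t n; move: hi; set d := (_ * n)%N; set r := (t %% n)%N; lia.
Qed.

(** With the exchange, slot 2 is filled at [q + 2] and then only at [n + 1], after [q + 1] steps.
    All other vertices of the period are succeeded within [q] steps. *)
Lemma lone_slot_at i : lone slot_at i -> (i %% n)%N = q.+2.
Proof.
have n0 : (0 < n)%N by rewrite en addn2.
move=> ln; have rn := ltn_pmod i n0.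
have base c r : lone slot_at (r + c * n) -> lone slot_at r.
  move=> l u hu; have := l (u + c * n)%N.
  rewrite !slot_at_shift (inj_eq perm_inj); apply.
  by rewrite ltn_add2r [(r + _ + _)%N]addnAC ltn_add2r.
have {ln base} : lone slot_at (i %% n)%N.
  by apply: (base (i %/ n)%N); rewrite addnC -divn_eq.
move: rn; set r := (i %% n)%N => rn ln; apply/eqP/negPn/negP => rq.
have out u : (r < u <= r + q)%N -> slot_at u = slot_at r -> False.
  by move=> hu e; have := ln u; rewrite e eqxx addnS ltnS => /(_ hu).
have rv := slot_at_low rn.
case: (leqP q.+2 r) => rq2; last first.
  apply: (out (r + q)%N); first by lia.
  by apply: val_inj; rewrite rv slot_at_low ?modnDr //; lia.
have high e s : (s < q)%N -> (r %% q = s)%N -> (r < n + e <= r + q)%N -> (e < q)%N ->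
    (if swap && (e == 0) then 3 else if swap && (e == 1) then 2 else (e + 2) %% q)%N = s ->
    False.
  move=> sq rs h1 h2 h3; apply: (out (n + e)%N) => //; apply: val_inj.
  by rewrite rv slot_at_high // h3 rs.
case: (ltnP r (2 * q)) => r2.
  have [s sq rs] : exists2 s, (s < q)%N & r = (s + 1 * q)%N by exists (r - q)%N; lia.
  have rm : (r %% q = s)%N by rewrite rs mod_addM.
  case: (boolP (swap && (s == 3))) => [/andP[sw /eqP e]|ns].
    by apply: (high 0 s) => //; rewrite ?sw ?e //; lia.
  apply: (high (s - 2)%N s) => //; [lia | lia |].
  have -> : (swap && (s - 2 == 0)%N) = false.
    by apply: contraNF ns => /andP[-> ?] /=; lia.
  have -> : (swap && (s - 2 == 1)%N) = false.
    by apply: contraNF ns => /andP[-> ?] /=; lia.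
  by rewrite subnK ?modn_small //; lia.
have [s s2 rs] : exists2 s, (s < 2)%N & r = (s + 2 * q)%N by exists (r - 2 * q)%N; lia.
have sq : (s < q)%N by lia.
have rm : (r %% q = s)%N by rewrite rs mod_addM.
apply: (high (s + q - 2)%N s) => //; [lia | lia |].
have -> : (s + q - 2 == 0)%N = false by lia.
have -> : (s + q - 2 == 1)%N = false by lia.
by rewrite !andbF subnK ?modnDr ?modn_small //; lia.
Qed.

Lemma slot_at_gap i : ~ (lone slot_at i /\ lone slot_at (i + q.+1)).
Proof.
move=> [/lone_slot_at h1 /lone_slot_at h2].
have : ((q.+2 + q.+1) %% n = q.+2)%N by rewrite -{1}h1 modnDml.
have -> : (q.+2 + q.+1 = n + 1)%N by rewrite en; lia.
have n1 : (1 < n)%N by rewrite en; lia.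
by rewrite modnDl modn_small.
Qed.

Definition cyclic_scheme : scheme q n :=
  Scheme en (fun i => etrans (congr1 (fun k => slot_at (i + k)) (esym (mul1n n)))
    (slot_at_shift 1 i)) slot_at_window slot_at_gap.

End CyclicScheme.

Local Close Scope ring_scope.

Theorem theorem2p2 (R : realType) (k : nat) (hk : (1 <= k)%N) :
  (exists K : {set {set 'I_(4 * k + 6)}},
     triangulation R K (sphere R (2 * k) `*` sphere R 1)) /\
  (exists K : {set {set 'I_(4 * k + 8)}},
     triangulation_nonorientable_sphere_bundle R (2 * k + 1) K).
Proof.
pose m := (2 * k)%N; pose m' := (2 * k + 1)%N.
(* From [k >= 1]: the exchanged slots 0 and 1, rotated by two, become 2 and 3 without wrapping
   around. *)
have qm : (3 < m.+2)%N by rewrite /m; lia.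
have qm' : (3 < m'.+2)%N by rewrite /m'; lia.
have en : (4 * k + 6 = 2 * m.+2 + 2)%N by rewrite /m; lia.
have en' : (4 * k + 8 = 2 * m'.+2 + 2)%N by rewrite /m'; lia.
pose S := cyclic_scheme false qm en; pose S' := cyclic_scheme true qm' en'.
split.
  exists (strip_complex S); split; first exact: strip_complex_simplicial.
  by apply: strip_complex_homeomorphic; rewrite odd_monodromy.
exists (strip_complex S'); split.
- exact: strip_complex_simplicial.
- exact: strip_complex_bundle.
- by apply: strip_complex_nonorientable; [exact: ltnW | rewrite odd_monodromy].
Qed.
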